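(* For each $\kappa\ge0$ let $(\rho_\kappa,v_\kappa,\phi_\kappa)$ be the peaked solitary wave solution with speed $c_\kappa$ (as defined in the context). Then for any $\alpha\in(0,1/3)$, $\beta\in(0,2/3)$ and $p\in[1,3/2)$, it holds that $$\phi_\kappa\to\phi_0\ \text{ in } C^{1,\alpha}(\mathbb R),\qquad \rho_\kappa-1\to\rho_0-1\ \text{ in } L^p(\mathbb R),\qquad v_\kappa\to v_0\ \text{ in } C^{\beta}(\mathbb R)$$ as $\kappa\to0$.
   Context: Speeds: for $\kappa>0$, $c_\kappa$ is the unique root in $(\sqrt\kappa,\infty)$ of $z^{\kappa}\left[(z-\sqrt\kappa)^2+1\right]=\exp\left((z^2-\kappa)/2\right)\kappa^{\kappa/2}$ (it satisfies $c_\kappa>\sqrt{1+\kappa}$); $c_0>1$ is the unique positive root of $z^2+1=\exp(z^2/2)$. Traveling wave equations with speed $c$ (where $'=d/d\xi$ and $\rho>0$): $$-c\rho'+(\rho v)'=0,\qquad \rho(-cv'+vv')+\kappa\rho'=-\rho\phi',\qquad -\phi''=\rho-e^\phi,$$ with far-field condition $\rho\to1$, $v\to0$, $\phi\to0$ as $\xi\to-\infty$. A peaked solitary wave is a triple $(\rho,v,\phi)(\xi)$ satisfying these equations and the far-field condition for $\xi\in\mathbb R\setminus\{0\}$ in the classical sense, and such that: (i) $\rho(\xi)=\rho(-\xi)$, $v(\xi)=v(-\xi)$, $\phi(\xi)=\phi(-\xi)$ for $\xi\ne0$; (ii) $\rho',v',\phi'>0$ on $(-\infty,0)$; (iii) at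 $\xi=0$ the right derivative of $(\rho,v)(\xi)$ is not equal to the left derivative. The paper asserts that for $c=c_\kappa$, $\kappa\ge0$, there is a unique peaked solitary wave; the subscript $\kappa$ indicates its dependence on $\kappa$.
   Formalization: Peaked solitary waves are also required to have φ of class C¹ across ξ=0 and v(0) equal to its limit; under (i)–(iii) alone, cutting the left profile earlier and reflecting it gives other waves. The derivatives in (iii) are one-sided limits of ρ', v', possibly infinite. *)

(* Defs.v *)
From HB Require Import structures.
From mathcomp Require Import all_boot all_order all_algebra.
From mathcomp Require Import all_classical all_reals all_analysis.

Set Implicit Arguments.
Unset Strict Implicit.
Unset Printing Implicit Defensive.

Import Order.TTheory GRing.Theory Num.Theory.
Import numFieldNormedType.Exports.

Local Open Scope classical_set_scope.
Local Open Scope ring_scope.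

(* In ring_scope these notations denote derivatives of polynomials. *)
Local Notation "f ^` ()" := (derive1 f) : ring_scope.
Local Notation "f ^` ( n )" := (derive1n n f) : ring_scope.

(* The equation characterizes c uniquely: for k > 0 it also has the root
   z = sqrt k, excluded here by the strict inequality; for k = 0 it has the root
   z = 0, excluded by positivity. *)
Definition peaked_speed {R : realType} (k c : R) : Prop :=
  if k == 0 then 0 < c /\ c ^+ 2 + 1 = expR (c ^+ 2 / 2)
  else Num.sqrt k < c /\
       c `^ k * ((c - Num.sqrt k) ^+ 2 + 1) =
         expR ((c ^+ 2 - k) / 2) * k `^ (k / 2).

(* One-sided derivatives at 0 are the one-sided limits of the derivative, taken
   in \bar R: for k = 0 the density is unbounded at 0, so difference quotients at
   0 make no sense for it, and both rho' and v' tend to +oo on the left of 0 and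
   to -oo on the right. *)
Definition left_derivative0 {R : realType} (f : R -> R) (l : \bar R) : Prop :=
  (f^`() x)%:E @[x --> (0 : R)^'-] --> l.

Definition right_derivative0 {R : realType} (f : R -> R) (l : \bar R) : Prop :=
  (f^`() x)%:E @[x --> (0 : R)^'+] --> l.

(* The equations and symmetries concern x != 0 only.  The value rho 0 is left
   unconstrained (for k = 0 the density blows up there).  The last three fields
   say how v and phi, seen as functions on the whole line, behave at 0: v takes
   its limit value, and phi is of class C^1, so that only (rho, v) has a corner.
   Continuity of phi' at 0 cannot be dropped: otherwise cutting the left profile
   at an arbitrary point and reflecting it would again be a peaked wave, and
   uniqueness would fail. *)
Record peaked_solitary_wave {R : realType} (k c : R) (rho v phi : R -> R)
    : Prop := PeakedSolitaryWave {
  psw_density_gt0 : forall x : R, x != 0 -> 0 < rho x;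
  psw_derivable : forall x : R, x != 0 ->
    [/\ derivable rho x 1, derivable v x 1,
        derivable phi x 1 & derivable (phi^`()) x 1];
  psw_continuity : forall x : R, x != 0 ->
    - c * rho^`() x + (fun y => rho y * v y)^`() x = 0;
  psw_momentum : forall x : R, x != 0 ->
    rho x * (- c * v^`() x + v x * v^`() x) + k * rho^`() x =
      - (rho x * phi^`() x);
  psw_poisson : forall x : R, x != 0 ->
    - phi^`(2) x = rho x - expR (phi x);
  psw_far_rho : rho x @[x --> -oo] --> (1 : R);
  psw_far_v : v x @[x --> -oo] --> (0 : R);
  psw_far_phi : phi x @[x --> -oo] --> (0 : R);
  psw_even : forall x : R, x != 0 ->
    [/\ rho x = rho (- x), v x = v (- x) & phi x = phi (- x)];
  psw_increasing : forall x : R, x < 0 ->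
    [/\ 0 < rho^`() x, 0 < v^`() x & 0 < phi^`() x];
  psw_peak : exists lrho lv rrho rv : \bar R,
    [/\ left_derivative0 rho lrho, left_derivative0 v lv,
        right_derivative0 rho rrho, right_derivative0 v rv
      & (rrho, rv) <> (lrho, lv)];
  psw_v_continuous0 : {for 0, continuous v};
  psw_phi_derivable0 : derivable phi 0 1;
  psw_dphi_continuous0 : {for 0, continuous (phi^`())}
}.

Definition sup_norm {R : realType} (f : R -> R) : \bar R :=
  ereal_sup (range (fun x : R => `|f x|%:E)).

Definition holder_seminorm {R : realType} (b : R) (f : R -> R) : \bar R :=
  ereal_sup [set (`|f xy.1 - f xy.2| / `|xy.1 - xy.2| `^ b)%:E
            | xy in [set xy : R * R | xy.1 != xy.2]].

Definition holder_norm {R : realType} (b : R) (f : R -> R) : \bar R :=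
  (sup_norm f + holder_seminorm b f)%E.

Definition holder1_norm {R : realType} (a : R) (f : R -> R) : \bar R :=
  (sup_norm f + holder_norm a (f^`()))%E.

(* C^b(R) for b in ]0, 1]; finiteness of the norm entails continuity. *)
Definition holder {R : realType} (b : R) (f : R -> R) : Prop :=
  (holder_norm b f < +oo)%E.

(* C^{1,a}(R); derivability is required separately because f^`() is total. *)
Definition holder1 {R : realType} (a : R) (f : R -> R) : Prop :=
  (forall x : R, derivable f x 1) /\ (holder1_norm a f < +oo)%E.

(* Convergence of f k to f 0 as k -> 0+ in a normed function space includes
   membership of every f k, k >= 0, in the space. *)
Definition cvg0_holder {R : realType} (b : R) (f : R -> R -> R) : Prop :=
  (forall k : R, 0 <= k -> holder b (f k)) /\
  holder_norm b (f k \- f 0) @[k --> (0 : R)^'+] --> 0%E.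

Definition cvg0_holder1 {R : realType} (a : R) (f : R -> R -> R) : Prop :=
  (forall k : R, 0 <= k -> holder1 a (f k)) /\
  holder1_norm a (f k \- f 0) @[k --> (0 : R)^'+] --> 0%E.

Definition cvg0_Lp {R : realType} (p : R) (f : R -> R -> R) : Prop :=
  (forall k : R, 0 <= k -> f k \in Lfun (@lebesgue_measure R) p%:E) /\
  'N[@lebesgue_measure R]_p%:E[EFin \o (f k \- f 0)%R]%E
    @[k --> (0 : R)^'+] --> 0%E.

(* Main.v *)
Require Import Defs.
From HB Require Import structures.
From mathcomp Require Import all_boot all_order all_algebra.
From mathcomp Require Import all_classical all_reals all_analysis.
From mathcomp Require Import measurable_realfun.
From mathcomp Require Import ring lra.

(** With u := c - v and psi := phi', the equations integrate to rho = c / u,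
    phi = (c^2 - u^2)/2 - k ln (c/u) and an energy identity expressing psi^2
    in terms of u and phi.  If u had a limit larger than r := sqrt k at 0, then
    rho' and v' would tend to 0 there and the wave would have no peak; so
    u -> r, and exp (phi 0) = 1 + (c - r)^2.
    - Continuity of the speed: the bounds on phi 0 give
      d^2/2 - k <= ln (1 + d^2) <= d^2/2 + d r for d = c - r.
    - Hoelder bounds: both u^(3/2) and psi^3 are Lipschitz, uniformly in k.
    - Uniform convergence of u: the inverse function of u has the explicit
      derivative - (s^2 - k) / (s psi), which converges uniformly away from
      s = 0 and s = c; the end s = 0 is controlled by u^(3/2) >= const |x|.
      Then phi and psi converge uniformly by the integrated equations, and
      interpolation with the Hoelder bounds gives the convergence in C^(1,a)
      and C^b.
    - L^p: (rho - 1)^3 x^2 (1 + |x|)^4 is bounded uniformly in k.  Near 0 this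
      is u^(3/2) >= const |x| again; at infinity phi'' >= a phi with a > 0
      because c^2 > 1 + k, and rho - 1 <= phi.  Dominated convergence
      concludes. *)

Import Order.TTheory GRing.Theory Num.Theory.
Import numFieldNormedType.Exports.

Local Open Scope ring_scope.
Local Open Scope classical_set_scope.

Set Implicit Arguments.
Unset Strict Implicit.
Unset Printing Implicit Defensive.

(* In ring_scope this notation denotes the derivative of polynomials. *)
Local Notation "f ^` ()" := (derive1 f) : ring_scope.

(** * Calculus on the negative half-line *)

Section Calculus.
Variable R : realType.
Implicit Types (f g df : R -> R) (x y z a b l s : R).

(** A direct comparison of the differential systems of two waves fails at both ends: in u' = - psi u
    / (u^2 - k) numerator and denominator both vanish at the peak, and the rest state u = c is
    reached only at -oo. With u as the independent variable, the integrated equations make psi an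
    explicit function of u, so that comparing two inverse functions is a mere integration over a
    compact range of levels. The exponents come from k = 0, where u behaves like |x|^(2/3) at the
    peak: rho blows up like |x|^(-2/3), which is in L^p near 0 exactly for p < 3/2, and psi behaves
    like |x|^(1/3). Uniform regularity is kept in the form |f x - f y|^3 <= A |x - y|^n, with n = 2
    for u and n = 1 for psi, so that real powers enter only when norms are estimated. The strict
    bounds on the Hoelder exponents leave a positive power of the sup norm in the interpolation. *)

Lemma is_derive_add f g x a b : is_derive x 1 f a -> is_derive x 1 g b ->
  is_derive x 1 (fun y => f y + g y) (a + b).
Proof. move=> fa gb; exact: is_deriveD. Qed.

Lemma is_derive_opp f x a : is_derive x 1 f a ->
  is_derive x 1 (fun y => - f y) (- a).
Proof. move=> fa; exact: is_deriveN. Qed.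

Lemma is_derive_mul f g x a b : is_derive x 1 f a -> is_derive x 1 g b ->
  is_derive x 1 (fun y => f y * g y) (a * g x + f x * b).
Proof.
move=> fa gb; have := is_deriveM fa gb.
by rewrite /GRing.scale /= addrC (mulrC (g x)).
Qed.

Lemma is_derive_inv f x a : f x != 0 -> is_derive x 1 f a ->
  is_derive x 1 (fun y => (f y)^-1) (- a / f x ^+ 2).
Proof.
move=> fx0 fa; have := is_deriveV fx0 fa.
by rewrite /GRing.scale /= mulNr mulNr (mulrC a).
Qed.

Lemma is_derive_exp f x a (n : nat) : is_derive x 1 f a ->
  is_derive x 1 (fun y => f y ^+ n) (n%:R * f x ^+ n.-1 * a).
Proof. 
move=> fa; have := is_deriveX n fa; rewrite /GRing.scale /=.
rewrite (_ : (f ^+ n) = (fun y => f y ^+ n)) //.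
by apply/funext => y; elim: n => [|n IH]; rewrite ?expr0// !exprS /= -IH.
Qed.

Lemma is_derive_expR_comp f x a : is_derive x 1 f a ->
  is_derive x 1 (fun y => expR (f y)) (expR (f x) * a).
Proof. by move=> fa; apply: is_derive1_comp. Qed.

Lemma is_derive_ln_comp f x a : 0 < f x -> is_derive x 1 f a ->
  is_derive x 1 (fun y => ln (f y)) ((f x)^-1 * a).
Proof. by move=> fx fa; apply: is_derive1_comp; apply: is_derive1_ln. Qed.

Lemma is_derive_derive1 f x : derivable f x 1 -> is_derive x 1 f (f^`() x).
Proof. by move=> df; apply: DeriveDef => //; rewrite derive1E. Qed.

Lemma derive1_is_derive f x a : is_derive x 1 f a -> f^`() x = a.
Proof. by move=> fa; rewrite derive1E derive_val. Qed.

Lemma is_derive_continuous f x a : is_derive x 1 f a -> {for x, continuous f}.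
Proof. by move=> [fa _]; apply: differentiable_continuous; apply/derivable1_diffP. Qed.

Lemma is_derive_subst f x a b : is_derive x 1 f a -> a = b -> is_derive x 1 f b.
Proof. by move=> fa <-. Qed.

End Calculus.

(** The derivative stays an existential variable and is built from the syntax of the function, the
    derivatives of unknown functions being taken from the context. Typically run under
    [is_derive_subst], which turns the comparison with the intended formula into a separate
    algebraic goal. *)
Ltac isder :=
  lazymatch goal with
    | |- is_derive _ _ (fun _ => ?c) _ => exact: is_derive_cst
    | |- is_derive _ _ (fun y => y) _ => exact: is_derive_id
    | |- is_derive _ _ (fun y => _ + _) _ => eapply is_derive_add; [isder|isder]
    | |- is_derive _ _ (fun y => - _) _ => eapply is_derive_opp; isder
    | |- is_derive _ _ -%R _ => eapply is_derive_opp; exact: is_derive_id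
    | |- is_derive _ _ (fun y => _ * _) _ => eapply is_derive_mul; [isder|isder]
    | |- is_derive _ _ (fun y => _ ^-1) _ => eapply is_derive_inv; [|isder]
    | |- is_derive _ _ (fun y => _ ^+ _) _ => eapply is_derive_exp; isder
    | |- is_derive _ _ (fun y => expR _) _ => eapply is_derive_expR_comp; isder
    | |- is_derive _ _ (fun y => ln _) _ => eapply is_derive_ln_comp; [|isder]
    | |- _ => eassumption
    end.

Section HalfLine.
Variable R : realType.
Implicit Types (f g df : R -> R) (x y z a b l s : R).

Lemma MVT_lt0 f df x y : (forall z, z < 0 -> is_derive z 1 f (df z)) ->
  x < y -> y < 0 -> exists2 z, x < z < y & f y - f x = df z * (y - x).
Proof.
move=> fdf xy y0.
have [z|z|z] := @MVT _ f df x y xy.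
- rewrite in_itv /= => /andP[_ zy]; apply: fdf; lra.
- apply: derivable_within_continuous => t; rewrite in_itv /= => /andP[_ ty].
  by have [] := fdf t ltac:(lra).
- by rewrite in_itv /= => zxy ->; exists z.
Qed.

Lemma derive_ge0_nondecreasing f df x y :
  (forall z, z < 0 -> is_derive z 1 f (df z)) ->
  (forall z, x < z -> z < y -> 0 <= df z) -> x <= y -> y < 0 -> f x <= f y.
Proof.
move=> fdf df0; rewrite le_eqVlt => /predU1P[->//|xy] y0.
have [z /andP[xz zy] e] := MVT_lt0 fdf xy y0.
have := df0 _ xz zy; nra.
Qed.

Lemma derive_le0_nonincreasing f df x y :
  (forall z, z < 0 -> is_derive z 1 f (df z)) ->
  (forall z, x < z -> z < y -> df z <= 0) -> x <= y -> y < 0 -> f y <= f x.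
Proof.
move=> fdf df0; rewrite le_eqVlt => /predU1P[->//|xy] y0.
have [z /andP[xz zy] e] := MVT_lt0 fdf xy y0.
have := df0 _ xz zy; nra.
Qed.

Lemma derive_gt0_increasing f df x y :
  (forall z, z < 0 -> is_derive z 1 f (df z)) ->
  (forall z, z < 0 -> 0 < df z) -> x < y -> y < 0 -> f x < f y.
Proof.
move=> fdf df0 xy y0.
have [z /andP[xz zy] e] := MVT_lt0 fdf xy y0.
have := df0 z ltac:(lra); nra.
Qed.

Lemma derive_slope_ge f df x y s :
  (forall z, z < 0 -> is_derive z 1 f (df z)) ->
  (forall z, x < z -> z < y -> s <= df z) -> x <= y -> y < 0 ->
  s * (y - x) <= f y - f x.
Proof.
move=> fdf dfs; rewrite le_eqVlt => /predU1P[->//|xy] y0.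
  by rewrite !subrr mulr0.
have [z /andP[xz zy] ->] := MVT_lt0 fdf xy y0.
by apply: ler_wpM2r; [lra|exact: dfs].
Qed.

Lemma derive_norm_le f df x y s :
  (forall z, z < 0 -> is_derive z 1 f (df z)) ->
  (forall z, z < 0 -> `|df z| <= s) -> x < 0 -> y < 0 ->
  `|f x - f y| <= s * `|x - y|.
Proof.
move=> fdf dfs; wlog xy : x y / x < y => [hw x0 y0|].
  have [xy|xy|->] := ltgtP x y; first exact: hw.
    by rewrite distrC (distrC x); exact: hw.
  by rewrite !subrr normr0 mulr0.
move=> x0 y0; have [z /andP[xz zy] e] := MVT_lt0 fdf xy y0.
rewrite distrC e normrM (distrC x) ler_wpM2r//.
by apply: dfs; lra.
Qed.

Lemma near_Ny_lt a : \forall x \near -oo, (x : R) < a.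
Proof. by exists a; split=> //; exact: num_real. Qed.

Lemma cvg_Ny_le f l b x : f z @[z --> -oo] --> l ->
  (forall y, y < x -> f y <= b) -> l <= b.
Proof.
move=> fl fb; apply: (cvgr_to_le fl).
by near=> y; apply: fb; near: y; exact: near_Ny_lt.
Unshelve. all: by end_near. Qed.

Lemma cvg_Ny_ge f l b x : f z @[z --> -oo] --> l ->
  (forall y, y < x -> b <= f y) -> b <= l.
Proof.
move=> fl fb; apply: (cvgr_to_ge fl).
by near=> y; apply: fb; near: y; exact: near_Ny_lt.
Unshelve. all: by end_near. Qed.

Lemma near_left_gt x : x < 0 -> \forall y \near 0^'-, x < (y : R) < 0.
Proof.
move=> x0; near=> y; apply/andP; split.
  by near: y; apply: nbhs_left_gt.
by near: y; apply: nbhs_left_lt.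
Unshelve. all: by end_near. Qed.

Lemma cvg_left_le f l b x : x < 0 -> f z @[z --> 0^'-] --> l ->
  (forall y, x < y -> y < 0 -> f y <= b) -> l <= b.
Proof.
move=> x0 fl fb; apply: (cvgr_to_le fl).
near=> y; have /andP[] : x < y < 0 by near: y; exact: near_left_gt.
exact: fb.
Unshelve. all: by end_near. Qed.

Lemma cvg_left_ge f l b x : x < 0 -> f z @[z --> 0^'-] --> l ->
  (forall y, x < y -> y < 0 -> b <= f y) -> b <= l.
Proof.
move=> x0 fl fb; apply: (cvgr_to_ge fl).
near=> y; have /andP[] : x < y < 0 by near: y; exact: near_left_gt.
exact: fb.
Unshelve. all: by end_near. Qed.

Lemma increasing_gt_cvg_Ny f df l x :
  (forall z, z < 0 -> is_derive z 1 f (df z)) ->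
  (forall z, z < 0 -> 0 < df z) -> f z @[z --> -oo] --> l -> x < 0 -> l < f x.
Proof.
move=> fdf df0 fl x0; apply: (@le_lt_trans _ _ (f (x - 1))).
  apply: (cvg_Ny_le (x := x - 1) fl) => y yx; apply/ltW.
  by apply: (derive_gt0_increasing fdf df0) => //; lra.
by apply: (derive_gt0_increasing fdf df0) => //; lra.
Qed.

Lemma derive0_eq_cvg_Ny f l x :
  (forall z, z < 0 -> is_derive z 1 f 0) -> f z @[z --> -oo] --> l -> x < 0 ->
  f x = l.
Proof.
move=> f0 fl x0; have cf y : y < x -> f y = f x.
  move=> yx; have [z _] := MVT_lt0 (df := fun=> 0) f0 yx x0.
  by rewrite mul0r => /eqP; rewrite subr_eq0 => /eqP.
apply/eqP; rewrite eq_le; apply/andP; split.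
  by apply: (cvg_Ny_ge (x := x) fl) => y /cf ->.
by apply: (cvg_Ny_le (x := x) fl) => y /cf ->.
Qed.

(** Both asymptotic arguments, that psi tends to 0 at -oo and that c^2 > 1 + k, end with this
    contradiction for [phi]. *)
Lemma derive_not_bounded_below f df s b x :
  (forall z, z < 0 -> is_derive z 1 f (df z)) -> x < 0 -> 0 < s ->
  (forall z, z < x -> s <= df z) -> ~ (forall z, z < 0 -> b <= f z).
Proof.
move=> fdf x0 s0 dfs fb.
pose y := x - (`|f x - b| + 1) / s.
have yx : y < x by rewrite /y ltrBlDr ltrDl divr_gt0// ltr_wpDl.
have := derive_slope_ge (s := s) fdf (fun z _ => dfs z) (ltW yx) x0.
have -> : s * (x - y) = `|f x - b| + 1.
  by rewrite /y opprB addrC subrK mulrC divfK// gt_eqF.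
have := fb y ltac:(lra); have := ler_norm (f x - b); lra.
Qed.

End HalfLine.

(** * Integration of the traveling wave equations *)

Section EvenFunctions.
Variable R : realType.
Implicit Types (f : R -> R) (x l : R).

Lemma even_compN f : (forall x, x != 0 -> f x = f (- x)) -> f \o -%R = f.
Proof.
move=> fN; apply/funext => x /=; have [->|x0] := eqVneq x 0; first by rewrite oppr0.
by rewrite -fN.
Qed.

Lemma even_derive1N f x : f \o -%R = f -> derivable f (- x) 1 ->
  f^`() x = - f^`() (- x).
Proof.
move=> fN df; rewrite -[in LHS]fN -mulrN1.
apply: derive1_is_derive.
exact: (is_derive1_comp (is_derive_derive1 df) (is_derive_opp (is_derive_id x 1))).
Qed.

Lemma left_derivative0_eq f l (m : \bar R) : f^`() x @[x --> 0^'-] --> l ->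
  left_derivative0 f m -> m = l%:E.
Proof.
move=> fl fm; apply: (cvg_unique (@ereal_hausdorff R) fm).
by apply: cvg_EFin => //; exact: nearW.
Qed.

Lemma right_derivative0_eq f l (m : \bar R) :
  f \o -%R = f -> (forall x, x < 0 -> derivable f x 1) ->
  f^`() x @[x --> 0^'-] --> l -> right_derivative0 f m -> m = (- l)%:E.
Proof.
move=> fN df fl fm; apply: (cvg_unique (@ereal_hausdorff R) fm).
have : (- f^`() (- x))%:E @[x --> 0^'+] --> (- l)%:E.
  apply: cvg_EFin; first exact: nearW.
  apply: cvgN; have := (cvg_at_leftNP (f^`()) 0 l).1 fl; rewrite oppr0; exact.
apply: cvg_trans; apply: near_eq_cvg; near=> x; congr (_%:E).
apply/esym/even_derive1N => //; apply: df; rewrite oppr_lt0.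
by near: x; exact: nbhs_right_gt.
Unshelve. all: by end_near. Qed.

End EvenFunctions.

Section Wave.
Variable R : realType.
Implicit Types (k c x y z : R) (u rho v phi psi : R -> R).

(* The left half of a wave, with u = c - v, so that rho = c / u, and
   psi = phi'. *)
Record half_wave k c u phi psi : Prop := HalfWave {
  hw_k_ge0 : 0 <= k;
  hw_c_gt : Num.sqrt k < c;
  hw_u_gt : forall x, x < 0 -> Num.sqrt k < u x;
  hw_u_lt : forall x, x < 0 -> u x < c;
  hw_psi_gt0 : forall x, x < 0 -> 0 < psi x;
  hw_du : forall x, x < 0 ->
    is_derive x 1 u (- (psi x * u x / (u x ^+ 2 - k)));
  hw_dphi : forall x, x < 0 -> is_derive x 1 phi (psi x);
  hw_dpsi : forall x, x < 0 -> is_derive x 1 psi (expR (phi x) - c / u x);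
  hw_phiE : forall x, x < 0 ->
    phi x = (c ^+ 2 - u x ^+ 2) / 2 - k * ln (c / u x);
  hw_energy : forall x, x < 0 -> psi x ^+ 2 / 2 =
    c * (u x - Num.sqrt k) ^+ 2 / u x - (1 + (c - Num.sqrt k) ^+ 2)
      + expR (phi x);
  hw_u_Ny : u x @[x --> -oo] --> c;
  hw_phi_Ny : phi x @[x --> -oo] --> 0;
  hw_u_left0 : u x @[x --> 0^'-] --> Num.sqrt k;
  hw_phi_left0 : phi x @[x --> 0^'-] --> phi 0;
  hw_psi_left0 : psi x @[x --> 0^'-] --> 0
}.

Lemma peaked_speed_gt k c : 0 <= k -> peaked_speed k c -> Num.sqrt k < c.
Proof.
move=> k0; rewrite /peaked_speed; case: eqVneq => [->|_] []//.
by rewrite sqrtr0.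
Qed.

Section Profile.
Variables (k c : R) (rho v phi : R -> R).
Hypotheses (k0 : 0 <= k) (ck : Num.sqrt k < c).
Hypothesis W : peaked_solitary_wave k c rho v phi.
Let u (x : R) : R := c - v x.
Let psi : R -> R := phi^`().

Let c0 : 0 < c. Proof. by apply: le_lt_trans ck; exact: sqrtr_ge0. Qed.

Let drho x : x < 0 -> is_derive x 1 rho (rho^`() x).
Proof. by move=> /ltr0_neq0/(psw_derivable W)[? _ _ _]; exact: is_derive_derive1. Qed.

Let dv x : x < 0 -> is_derive x 1 v (v^`() x).
Proof. by move=> /ltr0_neq0/(psw_derivable W)[_ ? _ _]; exact: is_derive_derive1. Qed.

Let dphi x : x < 0 -> is_derive x 1 phi (psi x).
Proof. by move=> /ltr0_neq0/(psw_derivable W)[_ _ ? _]; exact: is_derive_derive1. Qed.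

Let dpsi0 x : x < 0 -> is_derive x 1 psi (psi^`() x).
Proof. by move=> /ltr0_neq0/(psw_derivable W)[_ _ _ ?]; exact: is_derive_derive1. Qed.

Let rho_gt0 x : x < 0 -> 0 < rho x.
Proof. by move=> /ltr0_neq0/(psw_density_gt0 W). Qed.

Let drhov x : x < 0 ->
  (fun y => rho y * v y)^`() x = rho^`() x * v x + rho x * v^`() x.
Proof.
by move=> x0; apply: derive1_is_derive; exact: is_derive_mul (drho x0) (dv x0).
Qed.

Lemma density_velocity x : x < 0 -> rho x * u x = c.
Proof.
move=> x0.
have d0 z : z < 0 -> is_derive z 1 (fun y => rho y * v y - c * rho y) 0.
  move=> z0; eapply is_derive_subst.
    have h1 := drho z0; have h2 := dv z0; isder.
  have := psw_continuity W (ltr0_neq0 z0); rewrite drhov//; lra.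
have lim : (fun y => rho y * v y - c * rho y) y @[y --> -oo] --> 1 * 0 - c * 1.
  apply: cvgB; [apply: cvgM|apply: cvgMr]; by [exact: psw_far_rho W|exact: psw_far_v W].
by have := derive0_eq_cvg_Ny d0 lim x0; rewrite /u; lra.
Qed.

Lemma u_gt0 x : x < 0 -> 0 < u x.
Proof.
move=> x0; have := density_velocity x0; have := rho_gt0 x0 => r0 e.
by rewrite -(pmulr_rgt0 _ r0) e.
Qed.

Lemma rhoE x : x < 0 -> rho x = c / u x.
Proof.
by move=> x0; rewrite -(density_velocity x0) mulfK// gt_eqF// u_gt0.
Qed.

Lemma u_lt_c x : x < 0 -> u x < c.
Proof.
move=> x0; have : 0 < v x; last by rewrite /u; lra.
apply: (increasing_gt_cvg_Ny dv) => // [z z0|]; last exact: psw_far_v W.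
by have [] := psw_increasing W z0.
Qed.

(** Eliminates rho' between the continuity and momentum equations. Since psi, u and v' are positive,
    it forces u^2 > k. *)
Let dphi_dv x : x < 0 -> psi x * u x = v^`() x * (u x ^+ 2 - k).
Proof.
move=> x0; have xn := ltr0_neq0 x0; have r0 := rho_gt0 x0.
have e : rho^`() x * u x = rho x * v^`() x.
  have := psw_continuity W xn; rewrite drhov// /u; lra.
have m := psw_momentum W xn.
apply: (mulfI (lt0r_neq0 r0)).
rewrite mulrA -[rho x * psi x]opprK -m /u.
have := congr1 ( *%R k) e; rewrite /u.
move: (derive1 rho x) (derive1 v x) => A B; lra.
Qed.

Lemma u_gt_sqrt x : x < 0 -> Num.sqrt k < u x.
Proof.
move=> x0; have [_ v0 psi0] := psw_increasing W x0.
have := mulr_gt0 psi0 (u_gt0 x0); rewrite dphi_dv// pmulr_rgt0// subr_gt0 => ku.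
rewrite -(ltr_pXn2r (n := 2)) ?nnegrE ?sqrtr_ge0 ?(ltW (u_gt0 x0))//.
by rewrite sqr_sqrtr.
Qed.

Lemma u2k_gt0 x : x < 0 -> 0 < u x ^+ 2 - k.
Proof.
move=> x0; have := u_gt_sqrt x0; have := sqr_sqrtr k0; have := sqrtr_ge0 k; nra.
Qed.

Let dvE x : x < 0 -> v^`() x = psi x * u x / (u x ^+ 2 - k).
Proof.
by move=> x0; rewrite dphi_dv// mulfK// gt_eqF// u2k_gt0.
Qed.

Let du x : x < 0 -> is_derive x 1 u (- (psi x * u x / (u x ^+ 2 - k))).
Proof.
move=> x0; have h := dv x0; eapply is_derive_subst; first by rewrite /u; isder.
by rewrite dvE// add0r.
Qed.

Let dpsi x : x < 0 -> is_derive x 1 psi (expR (phi x) - c / u x).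
Proof.
move=> x0; apply: is_derive_subst (dpsi0 x0) _.
have := psw_poisson W (ltr0_neq0 x0); rewrite rhoE//= -/psi; lra.
Qed.

Let u_Ny : u x @[x --> -oo] --> c.
Proof.
by rewrite -[X in _ --> X]subr0; apply: cvgB; [exact: cvg_cst|exact: psw_far_v W].
Qed.

Let phiE x : x < 0 -> phi x = (c ^+ 2 - u x ^+ 2) / 2 - k * ln (c / u x).
Proof.
move=> x0; apply/eqP; rewrite -subr_eq0; apply/eqP.
pose h y := phi y - ((c ^+ 2 - u y ^+ 2) / 2 - k * ln (c / u y)).
apply: (derive0_eq_cvg_Ny (f := h)) => // [z z0|].
  have ? := du z0; have ? := dphi z0; have uz := u_gt0 z0; have u2 := u2k_gt0 z0.
  eapply is_derive_subst; first by rewrite /h; isder; rewrite ?divr_gt0// gt_eqF.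
  by rewrite /=; field; rewrite !gt_eqF.
rewrite (_ : 0 = 0 - ((c ^+ 2 - c ^+ 2) / 2 - k * ln (c / c))); last first.
  by rewrite divff ?gt_eqF// ln1 subrr mul0r mulr0 !subr0.
apply: cvgB; first exact: psw_far_phi W.
apply: cvgB.
  apply: cvgMl; apply: cvgB; first exact: cvg_cst.
  by apply: (cvgM u_Ny); exact: u_Ny.
apply: cvgMr; apply: (@continuous_cvg _ _ _ _ _ _ (@ln R)).
  by apply: continuous_ln; rewrite divr_gt0.
by apply: cvgMr; apply: cvgV => //; rewrite gt_eqF.
Qed.

Let phi_gt0 x : x < 0 -> 0 < phi x.
Proof.
apply: (increasing_gt_cvg_Ny dphi) => [z z0|]; last exact: psw_far_phi W.
by have [] := psw_increasing W z0.
Qed.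

Let psi_gt0 x : x < 0 -> 0 < psi x.
Proof. by move=> x0; have [] := psw_increasing W x0. Qed.

(* The energy is constant by the equations; its value is found at -oo, where
   psi tends to 0 because phi is bounded and increasing. *)
Let energy x : x < 0 -> psi x ^+ 2 / 2 =
  c * (u x - Num.sqrt k) ^+ 2 / u x - (1 + (c - Num.sqrt k) ^+ 2)
    + expR (phi x).
Proof.
pose r := Num.sqrt k.
pose g y := c * (u y - r) ^+ 2 / u y + expR (phi y).
pose h y := psi y ^+ 2 / 2 - g y.
have dh z : z < 0 -> is_derive z 1 h 0.
  move=> z0; have ? := du z0; have ? := dphi z0; have ? := dpsi z0.
  have uz := u_gt0 z0; have := u2k_gt0 z0; rewrite -(sqr_sqrtr k0) -/r => u2.
  eapply is_derive_subst; first by rewrite /h /g; isder; rewrite gt_eqF.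
  rewrite /= -(sqr_sqrtr k0) -/r; field; rewrite !gt_eqF//.
have hK z : z < 0 -> h z = h (- 1).
  move=> z0; have [z1|z1|-> //] := ltgtP z (- 1).
    have [t _] := MVT_lt0 (df := fun=> 0) dh z1 ltac:(lra).
    by rewrite mul0r; lra.
  have [t _] := MVT_lt0 (df := fun=> 0) dh z1 z0.
  by rewrite mul0r; lra.
pose L := h (- 1) + (c * (c - r) ^+ 2 / c + expR 0).
have g_Ny : h (- 1) + g y @[y --> -oo] --> L.
  apply: cvgD; first exact: cvg_cst.
  apply: cvgD.
    apply: cvgM; last by apply: cvgV => //; rewrite gt_eqF.
    apply: cvgMr; apply: (@continuous_cvg _ _ _ _ _ _ (fun z : R => z ^+ 2)).
      exact: exprn_continuous.
    by apply: cvgB; [exact: u_Ny|exact: cvg_cst].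
  apply: (@continuous_cvg _ _ _ _ _ _ (@expR R)); last exact: psw_far_phi W.
  exact: continuous_expR.
have psiE z : z < 0 -> psi z ^+ 2 / 2 = h (- 1) + g z.
  by move=> z0; rewrite -(hK z z0) /h subrK.
have L0 : L = 0.
  apply/eqP; rewrite eq_le; apply/andP; split; last first.
    apply: (cvg_Ny_ge (x := 0) g_Ny) => z z0.
    by rewrite -psiE// divr_ge0// sqr_ge0.
  rewrite leNgt; apply/negP => L_gt0.
  have [M [_ HM]] : \forall y \near -oo, L / 2 <= h (- 1) + g y.
    by apply: (cvgr_ge _ g_Ny); lra.
  (* Near -oo, psi^2 / 2 >= L / 2, hence the slope sqrt L; the minimum with -1 keeps the half-line
     negative. *)
  apply: (@derive_not_bounded_below _ phi psi (Num.sqrt L) 0 (Num.min M (- 1))).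
  - exact: dphi.
  - by rewrite gt_min; apply/orP; right; lra.
  - by rewrite sqrtr_gt0.
  - move=> z; rewrite lt_min => /andP[zM z1]; have z0 : z < 0 by lra.
    have := HM z zM; rewrite -psiE// => Lz.
    rewrite -(ler_pXn2r (n := 2)) ?nnegrE ?sqrtr_ge0 ?(ltW (psi_gt0 z0))//.
    rewrite sqr_sqrtr; lra.
  - by move=> z /phi_gt0/ltW.
move: L0; rewrite /L mulrAC divff ?gt_eqF// mul1r expR0 => L0 x0.
rewrite psiE// /g -/r; lra.
Qed.

Lemma velocity_compN : v \o -%R = v.
Proof. by apply: even_compN => x /(psw_even W)[]. Qed.

Lemma potential_compN : phi \o -%R = phi.
Proof. by apply: even_compN => x /(psw_even W)[]. Qed.

Lemma density_compN : rho \o -%R = rho.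
Proof. by apply: even_compN => x /(psw_even W)[]. Qed.

Lemma dphi0 : psi 0 = 0.
Proof.
have := even_derive1N (x := 0) potential_compN; rewrite oppr0 => /(_ (psw_phi_derivable0 W)).
rewrite -/psi; lra.
Qed.

Let psi_left0 : psi x @[x --> 0^'-] --> 0.
Proof.
by rewrite -[X in _ --> X]dphi0; apply: cvg_at_left_filter; exact: psw_dphi_continuous0 W.
Qed.

(* Otherwise v' and rho' would tend to 0 on both sides of 0, and the wave
   would have no peak. *)
Lemma u_at0 : u 0 = Num.sqrt k.
Proof.
have u_left0 : u x @[x --> 0^'-] --> u 0.
  apply: cvgB; first exact: cvg_cst.
  by apply: cvg_at_left_filter; exact: psw_v_continuous0 W.
apply/eqP; rewrite eq_le; apply/andP; split; last first.
  apply: (cvg_left_ge (x := - 1) _ u_left0); first lra.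
  by move=> y _ /u_gt_sqrt/ltW.
rewrite leNgt; apply/negP => ru; have r0 := sqrtr_ge0 k.
have u0 : 0 < u 0 by lra.
have u20 : 0 < u 0 ^+ 2 - k by have := sqr_sqrtr k0; nra.
have v'0 : v^`() x @[x --> 0^'-] --> 0.
  have : psi x * u x / (u x ^+ 2 - k) @[x --> 0^'-] --> 0 * u 0 / (u 0 ^+ 2 - k).
    apply: cvgM; first by apply: cvgM => //; exact: psi_left0.
    apply: cvgV; first by rewrite gt_eqF.
    by apply: cvgB; [apply: cvgM; exact: u_left0|exact: cvg_cst].
  rewrite !mul0r; apply: cvg_trans; apply: near_eq_cvg.
  by near=> x; rewrite dvE//; near: x; exact: nbhs_left_lt.
have rho'0 : rho^`() x @[x --> 0^'-] --> 0.
  have : c / u x * v^`() x / u x @[x --> 0^'-] --> c / u 0 * 0 / u 0.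
    have iu : (u x)^-1 @[x --> 0^'-] --> (u 0)^-1.
      by apply: cvgV; [rewrite gt_eqF|exact: u_left0].
    by apply: cvgM => //; apply: cvgM => //; apply: cvgMr.
  rewrite mulr0 mul0r; apply: cvg_trans; apply: near_eq_cvg.
  near=> x; have x0 : x < 0 by near: x; exact: nbhs_left_lt.
  rewrite -rhoE//; apply: (mulIf (lt0r_neq0 (u_gt0 x0))).
  rewrite divfK ?gt_eqF ?u_gt0//.
  have := psw_continuity W (ltr0_neq0 x0); rewrite drhov// /u; lra.
have dN (f : R -> R) : (forall x, x < 0 -> is_derive x 1 f (f^`() x)) ->
  forall x, x < 0 -> derivable f x 1 by move=> df x /df[].
have [lrho [lv [rrho [rv [h1 h2 h3 h4]]]]] := psw_peak W; apply.
rewrite (left_derivative0_eq rho'0 h1) (left_derivative0_eq v'0 h2).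
rewrite (right_derivative0_eq density_compN (dN _ drho) rho'0 h3).
by rewrite (right_derivative0_eq velocity_compN (dN _ dv) v'0 h4) oppr0.
Unshelve. all: by end_near. Qed.

Lemma peaked_half_wave : half_wave k c u phi psi.
Proof.
split => //; [exact: u_gt_sqrt|exact: u_lt_c|exact: psw_far_phi W| |].
  rewrite -u_at0; apply: cvgB; first exact: cvg_cst.
  by apply: cvg_at_left_filter; exact: psw_v_continuous0 W.
apply: cvg_at_left_filter; apply: differentiable_continuous.
by apply/derivable1_diffP; exact: psw_phi_derivable0 W.
Qed.

End Profile.
End Wave.

(** * Estimates on a single wave *)

Section HalfWaveEstimates.
Variable R : realType.
Implicit Types a b x y z : R.

Lemma ln_le_subr1 x : 0 < x -> ln x <= x - 1.
Proof. by move=> x0; rewrite -[in ln _](subrK 1 x) addrC; apply: le_ln1Dx; lra. Qed.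

(** Comes from 4 (a^2 + a b + b^2) - (a - b)^2 = 3 (a + b)^2. It makes a function with Lipschitz
    cube Hoelder continuous of exponent 1/3. *)
Lemma cube_dist_le a b : `|a - b| ^+ 3 <= 4 * `|a ^+ 3 - b ^+ 3|.
Proof.
have -> : a ^+ 3 - b ^+ 3 = (a - b) * (a ^+ 2 + a * b + b ^+ 2) by ring.
rewrite normrM [`|a ^+ 2 + _ + _|]ger0_norm; last by nra.
rewrite exprS [leRHS]mulrCA ler_wpM2l// real_normK ?num_real//.
have := sqr_ge0 (a + b); nra.
Qed.

(** The analogue for the power 3/2: a nonnegative function whose power 3/2 is Lipschitz is Hoelder
    continuous of exponent 2/3. In the square roots s and t it reads (s^2 - t^2)^3 <= (s^3 -
    t^3)^2. *)
Lemma cube_dist_le_sqrt a b : 0 <= a -> 0 <= b ->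
  `|a - b| ^+ 3 <= (a * Num.sqrt a - b * Num.sqrt b) ^+ 2.
Proof.
move=> a0 b0; have := sqr_sqrtr a0; have := sqr_sqrtr b0.
have := sqrtr_ge0 a; have := sqrtr_ge0 b.
move: (Num.sqrt a) (Num.sqrt b) => s t {a0 b0} + + <- <-.
have key (s' t' : R) : 0 <= t' -> t' <= s' ->
    (s' ^+ 2 - t' ^+ 2) ^+ 3 <= (s' ^+ 2 * s' - t' ^+ 2 * t') ^+ 2.
  move=> t0 ts.
  have -> : (s' ^+ 2 * s' - t' ^+ 2 * t') ^+ 2 =
    (s' ^+ 2 - t' ^+ 2) ^+ 3 +
    (s' - t') ^+ 2 * (t' ^+ 2 * (3 * s' ^+ 2 + 4 * s' * t' + 2 * t' ^+ 2)) by ring.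
  by rewrite lerDl mulr_ge0 ?sqr_ge0// mulr_ge0 ?sqr_ge0//; nra.
move=> t0 s0; have [st|ts] := leP s t.
  rewrite distrC -[leRHS]sqrrN opprB ger0_norm; [exact: key|nra].
by rewrite ger0_norm; [apply: key => //; exact: ltW|nra].
Qed.

Section OneWave.
Variables (k c : R) (u phi psi : R -> R).
Hypothesis H : half_wave k c u phi psi.
Let r : R := Num.sqrt k.
Let E : R := 1 + (c - r) ^+ 2.

Let r0 : 0 <= r. Proof. exact: sqrtr_ge0. Qed.
Let kE : k = r ^+ 2. Proof. by rewrite sqr_sqrtr// (hw_k_ge0 H). Qed.
Let rc : r < c. Proof. exact: hw_c_gt H. Qed.

Lemma hw_c_gt0 : 0 < c. Proof. exact: le_lt_trans rc. Qed.
Let c0 := hw_c_gt0.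

Let ur x : x < 0 -> r < u x. Proof. exact: hw_u_gt H x. Qed.
Let uc x : x < 0 -> u x < c. Proof. exact: hw_u_lt H x. Qed.
Lemma hw_u_gt0 x : x < 0 -> 0 < u x.
Proof. by move=> /ur; exact: le_lt_trans. Qed.
Let u0 := hw_u_gt0.
Let psi0 x : x < 0 -> 0 < psi x. Proof. exact: hw_psi_gt0 H x. Qed.

Lemma hw_u2k_gt0 x : x < 0 -> 0 < u x ^+ 2 - k.
Proof. by move=> /ur; have := r0; rewrite kE; nra. Qed.

Lemma hw_phi_gt0 x : x < 0 -> 0 < phi x.
Proof. exact: (increasing_gt_cvg_Ny (hw_dphi H) psi0 (hw_phi_Ny H)). Qed.

Lemma hw_u_decreasing x y : x < y -> y < 0 -> u y < u x.
Proof.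
move=> xy y0; rewrite -ltrN2.
apply: (derive_gt0_increasing (f := fun z => - u z)) xy y0 => z z0.
  exact: is_derive_opp (hw_du H z0).
by rewrite /= opprK divr_gt0 ?mulr_gt0 ?psi0 ?u0 ?hw_u2k_gt0.
Qed.

Lemma hw_phi_le0 x : x < 0 -> phi x <= phi 0.
Proof.
move=> x0; apply: (cvg_left_ge x0 (hw_phi_left0 H)) => y xy y0.
by apply/ltW; apply: (derive_gt0_increasing (hw_dphi H)).
Qed.

Lemma hw_ln_bounds x : x < 0 -> 0 <= k * ln (c / u x) <= k * (c - u x) / u x.
Proof.
move=> x0; have uz := u0 x0; have ux := uc x0; have kz := hw_k_ge0 H.
apply/andP; split.
  by rewrite mulr_ge0// ln_ge0// ler_pdivlMr// mul1r ltW.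
rewrite -mulrA ler_wpM2l//.
have -> : (c - u x) / u x = c / u x - 1 by field; rewrite gt_eqF.
by apply: ln_le_subr1; rewrite divr_gt0.
Qed.

(* Otherwise rho >= exp phi, so phi is concave, increasing and bounded below
   on a half-line. *)
Lemma hw_c_sqr_gt : 1 + k < c ^+ 2.
Proof.
rewrite ltNge; apply/negP => c2.
have dpsi_le0 z : z < 0 -> expR (phi z) - c / u z <= 0.
  move=> z0; have uz := u0 z0; have cu : 0 < c / u z by rewrite divr_gt0.
  rewrite subr_le0 -ler_ln ?posrE ?expR_gt0// expRK (hw_phiE H)//.
  (* With l = ln (c / u) this yields c^2 - u^2 <= 2 c^2 l, hence phi <= (c^2 - k) l <= l because c^2
     <= 1 + k. *)
  have : ln ((u z / c) ^+ 2) <= (u z / c) ^+ 2 - 1.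
    by apply: ln_le_subr1; rewrite exprn_gt0// divr_gt0.
  rewrite lnXn ?divr_gt0// -[u z / c]invf_div lnV ?posrE//.
  set l := ln _ => hl.
  have hl2 : (c / u z) ^- 2 * c ^+ 2 = u z ^+ 2 by field; rewrite !gt_eqF.
  have : (c ^+ 2 - u z ^+ 2) <= 2 * l * c ^+ 2.
    rewrite -hl2 -[X in X - _]mul1r -mulrBl ler_wpM2r ?sqr_ge0//.
    by move: hl; rewrite exprVn mulr2n; lra.
  have l0 : 0 <= l by rewrite ln_ge0// ler_pdivlMr// mul1r ltW// uc.
  nra.
have m1 : (- 1 : R) < 0 by lra.
apply: (derive_not_bounded_below (b := 0) (hw_dphi H) m1 (psi0 m1)).
  move=> z z1; apply: (derive_le0_nonincreasing (hw_dpsi H)) (ltW z1) m1.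
  by move=> t _ t1; apply: dpsi_le0; lra.
by move=> z /hw_phi_gt0/ltW.
Qed.

Lemma hw_energy0 : expR (phi 0) = E.
Proof.
have l1 : expR (phi x) @[x --> 0^'-] --> expR (phi 0).
  apply: (@continuous_cvg _ _ _ _ _ _ (@expR R)); last exact: hw_phi_left0 H.
  exact: continuous_expR.
have l2 : c * (u x - r) ^+ 2 / u x @[x --> 0^'-] --> 0.
  apply: (@squeeze_cvgr _ _ _ _ (fun=> 0) (fun x => c * (u x - r))); last 2 first.
  - exact: cvg_cst.
  - have : c * (u x - r) @[x --> 0^'-] --> c * (r - r).
      by apply: cvgMr; apply: cvgB; [exact: hw_u_left0 H|exact: cvg_cst].
    by rewrite subrr mulr0.
  near=> x; have x0 : x < 0 by near: x; exact: nbhs_left_lt.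
  have ux := ur x0; have uz := u0 x0.
  rewrite (divr_ge0 (mulr_ge0 (ltW c0) (sqr_ge0 _)) (ltW uz))/=.
  rewrite ler_pdivrMr// -mulrA ler_pM2l// expr2.
  by have := r0; have := ux; nra.
have l3 : psi x ^+ 2 / 2 - c * (u x - r) ^+ 2 / u x + E @[x --> 0^'-] -->
    0 * 0 / 2 - 0 + E.
  apply: cvgD; last exact: cvg_cst.
  apply: cvgB => //; apply: cvgM; last exact: cvg_cst.
  by apply: cvgM; exact: hw_psi_left0 H.
rewrite !mul0r subrr add0r in l3.
apply: (cvg_unique (@Rhausdorff R) l1).
apply: cvg_trans l3; apply: near_eq_cvg; near=> x.
rewrite (hw_energy H); first by rewrite -/r -/E; lra.
by near: x; exact: nbhs_left_lt.
Unshelve. all: by end_near. Qed.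

Lemma hw_psi_sqr_le x : x < 0 -> psi x ^+ 2 / 2 <= c * (u x - r) ^+ 2 / u x.
Proof.
move=> x0; rewrite (hw_energy H)// -/r -/E -hw_energy0.
by have := hw_phi_le0 x0; rewrite -ler_expR; lra.
Qed.

(** As a function of u, phi has slope - (u - r) (u + r) / u, and (u + r) / u <= 2. Hence phi + (u -
    r)^2 does not increase along the wave, and its limit at the peak is phi 0. *)
Lemma hw_phi0_sub_le x : x < 0 -> phi 0 - phi x <= (u x - r) ^+ 2.
Proof.
move=> x0; suff : phi 0 <= phi x + (u x - r) ^+ 2 by lra.
have l : phi y + (u y - r) ^+ 2 @[y --> 0^'-] --> phi 0 + (r - r) * (r - r).
  apply: cvgD; first exact: hw_phi_left0 H.
  by apply: cvgM; (apply: cvgB; [exact: hw_u_left0 H|exact: cvg_cst]).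
rewrite subrr mulr0 addr0 in l.
apply: (cvg_left_le x0 l) => y xy y0.
pose d z := psi z * (1 - 2 * u z / (u z + r)).
apply: (@derive_le0_nonincreasing _ (fun z => phi z + (u z - r) ^+ 2) d) (ltW xy) (y0).
  move=> z z0; have h1 := hw_dphi H z0; have h2 := hw_du H z0.
  eapply is_derive_subst; first by isder.
  have uz := u0 z0; have := hw_u2k_gt0 z0; have := r0.
  by rewrite /d kE /= => rz ?; field; rewrite !gt_eqF// ltr_wpDr.
move=> z _ zy; have z0 : z < 0 by lra.
have := ur z0; have := u0 z0; have := psi0 z0 => pz uz rz.
have := r0; rewrite /d pmulr_rle0// subr_le0 => ?; rewrite ler_pdivlMr; lra.
Qed.

(** In the energy identity the loss E - exp phi is at most E (phi 0 - phi), by convexity of exp,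
    hence of order (u - r)^2. Near the peak this matches [hw_psi_sqr_le] up to the bounded term
    E. *)
Lemma hw_psi_sqr_ge x : x < 0 ->
  (u x - r) ^+ 2 * (c / u x - E) <= psi x ^+ 2 / 2.
Proof.
move=> x0; rewrite (hw_energy H)// -/r -/E.
suff : E - expR (phi x) <= E * (u x - r) ^+ 2 by lra.
rewrite -hw_energy0; apply: le_trans (_ : expR (phi 0) * (phi 0 - phi x) <= _).
  have -> : phi x = phi 0 + (phi x - phi 0) by lra.
  rewrite expRD -[X in X - _]mulr1 -mulrBr ler_pM2l ?expR_gt0//.
  have := expR_ge1Dx (phi x - phi 0); lra.
by rewrite ler_pM2l ?expR_gt0// hw_phi0_sub_le.
Qed.

(** [w] is u^(3/2) and [q] is u u'^2, so that w'^2 = 9/4 q. Bounds on [q] from both sides, uniform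
    in k, are what the estimates at the peak rest on. *)
Let w y := u y * Num.sqrt (u y).
Let q y := u y * (psi y * u y / (u y ^+ 2 - k)) ^+ 2.

Let dw x : x < 0 ->
  is_derive x 1 w (3 / 2 * Num.sqrt (u x) * - (psi x * u x / (u x ^+ 2 - k))).
Proof.
move=> x0; have uz := u0 x0; have h1 := hw_du H x0.
have h2 := is_derive1_comp (is_derive1_sqrt uz) h1.
eapply is_derive_subst; first exact: is_derive_mul h1 h2.
have sz : 0 < Num.sqrt (u x) by rewrite sqrtr_gt0.
have := sqr_sqrtr (ltW uz); rewrite /=.
move: (psi x * u x / _) (Num.sqrt (u x)) sz => t s s0 <-.
by field; rewrite gt_eqF.
Qed.

Let dw_sqr x : x < 0 ->
  (3 / 2 * Num.sqrt (u x) * - (psi x * u x / (u x ^+ 2 - k))) ^+ 2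
  = 9 / 4 * q x.
Proof.
move=> x0; rewrite /q; move: (psi x * u x / _) => t.
by rewrite -[X in _ = _ * (X * _)](sqr_sqrtr (ltW (u0 x0))); field.
Qed.

(** The factor (u - r)^2 in the bound of psi^2 cancels the one in (u^2 - k)^2, leaving 2 c u^2 / (u
    + r)^2. *)
Let q_le x : x < 0 -> q x <= 2 * c.
Proof.
move=> x0; have uz := u0 x0; have u2 := hw_u2k_gt0 x0.
rewrite /q expr_div_n mulrA ler_pdivrMr ?exprn_gt0//.
apply: le_trans (_ : 2 * c * (u x - r) ^+ 2 * u x ^+ 2 <= _).
  have := hw_psi_sqr_le x0; rewrite ler_pdivlMr// => h.
  have := ler_wpM2r (sqr_ge0 (u x)) h.
  rewrite exprMn; lra.
rewrite kE subr_sqr exprMn [leRHS]mulrA ler_wpM2l//.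
  by rewrite mulr_ge0 ?sqr_ge0// mulr_ge0// ltW// hw_c_gt0.
by rewrite ler_pXn2r ?nnegrE ?addr_ge0 ?(ltW uz)// lerDl.
Qed.

(** The smallness of u makes c / u - E >= c / (2 u), hence psi^2 >= c (u - r)^2 / u; the factor 1/4
    pays for u + r <= 2 u. *)
Let q_ge x : x < 0 -> 2 * E * u x <= c -> c / 4 <= q x.
Proof.
move=> x0 uE; have uz := u0 x0; have u2 := hw_u2k_gt0 x0.
rewrite /q expr_div_n mulrA ler_pdivlMr ?exprn_gt0//.
have uxr : u x + r <= 2 * u x by have := ur x0; lra.
apply: le_trans (_ : c * (u x - r) ^+ 2 * u x ^+ 2 <= _).
  rewrite kE subr_sqr exprMn [leLHS]mulrA.
  have -> : c * (u x - r) ^+ 2 * u x ^+ 2 =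
    c / 4 * (u x - r) ^+ 2 * (2 * u x) ^+ 2 by field.
  rewrite ler_wpM2l//.
    by rewrite mulr_ge0 ?sqr_ge0// divr_ge0// ltW// hw_c_gt0.
  by rewrite ler_pXn2r ?nnegrE ?addr_ge0 ?mulr_ge0// ltW.
have h := hw_psi_sqr_ge x0.
have h1 : (u x - r) ^+ 2 * c <= psi x ^+ 2 * u x.
  apply: le_trans (_ : (u x - r) ^+ 2 * (2 * (c - E * u x)) <= _).
    by apply: ler_wpM2l; [exact: sqr_ge0|lra].
  have := ler_wpM2r (ltW uz) h.
  by rewrite -mulrA mulrBl divfK ?gt_eqF//; lra.
have := ler_wpM2r (sqr_ge0 (u x)) h1.
by rewrite exprMn; lra.
Qed.

Lemma hw_u_holder x y : x < 0 -> y < 0 ->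
  `|u x - u y| ^+ 3 <= 9 / 2 * c * `|x - y| ^+ 2.
Proof.
move=> x0 y0.
apply: le_trans (cube_dist_le_sqrt (ltW (u0 x0)) (ltW (u0 y0))) _.
rewrite -/(w x) -/(w y) -real_normK ?num_real//.
have c2 : 0 <= 9 / 2 * c by have := c0; lra.
have := @derive_norm_le _ w _ x y (Num.sqrt (9 / 2 * c)) dw _ x0 y0.
have dwn z : z < 0 ->
   `|3 / 2 * Num.sqrt (u z) * - (psi z * u z / (u z ^+ 2 - k))|
     <= Num.sqrt (9 / 2 * c).
  move=> z0; rewrite -(ler_pXn2r (n := 2)) ?nnegrE ?sqrtr_ge0//.
  rewrite real_normK ?num_real// dw_sqr// sqr_sqrtr//.
  by have := q_le z0; lra.
move=> /(_ dwn); rewrite -(ler_pXn2r (n := 2)) ?nnegrE ?mulr_ge0 ?sqrtr_ge0//.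
by rewrite exprMn sqr_sqrtr.
Qed.

(** The smallness condition persists from x to 0 because u decreases. There [q_ge] bounds the slope
    of u^(3/2) away from 0, with 3/4 sqrt c = sqrt (9/4 * c/4). *)
Lemma hw_u_lower x : x < 0 -> 2 * E * u x <= c ->
  3 / 4 * Num.sqrt c * - x <= u x * Num.sqrt (u x).
Proof.
move=> x0 uE; set s : R := 3 / 4 * Num.sqrt c.
have l : s * (y - x) @[y --> 0^'-] --> s * - x.
  have -> : s * - x = s * (0 - x) by rewrite sub0r.
  apply: cvg_at_left_filter.
  by eapply (@is_derive_continuous _ (fun y => s * (y - x))); isder.
apply: (cvg_left_le x0 l) => y xy y0.
have E0 : 0 <= E by rewrite addr_ge0// sqr_ge0.
have s0 : 0 <= s by rewrite mulr_ge0 ?sqrtr_ge0.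
apply: le_trans (_ : - w y - - w x <= _); last first.
  rewrite opprK addrC lerBlDr lerDl mulr_ge0 ?sqrtr_ge0//.
  exact/ltW/u0.
apply: (derive_slope_ge (fun z (z0 : z < 0) => is_derive_opp (dw z0))) (ltW xy) (y0).
move=> z xz zy; have z0 : z < 0 by lra.
have uz := u0 z0; have u2 := hw_u2k_gt0 z0; have pz := psi0 z0.
rewrite mulrN opprK -(ler_pXn2r (n := 2)) ?nnegrE//; last first.
  by rewrite mulr_ge0 ?divr_ge0// ?mulr_ge0 ?sqrtr_ge0// ltW.
have := dw_sqr z0; rewrite mulrN sqrrN => ->.
rewrite /s exprMn sqr_sqrtr ?(ltW c0)//.
have : c / 4 <= q z; last lra.
apply: q_ge => //; apply: le_trans uE; rewrite ler_wpM2l ?mulr_ge0//.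
by apply/ltW/hw_u_decreasing.
Qed.

Lemma hw_psi_sqr_le_u x : x < 0 -> psi x ^+ 2 <= 2 * c * u x.
Proof.
move=> x0; have uz := u0 x0; have h := hw_psi_sqr_le x0.
have : c * (u x - r) ^+ 2 / u x <= c * u x; last lra.
rewrite ler_pdivrMr// -mulrA ler_pM2l// -expr2.
have := ur x0; have := r0; nra.
Qed.

(** The derivative of psi^3 is 3 psi^2 (exp phi - c / u), and psi^2 <= 2 c u absorbs the unbounded 1
    / u. *)
Lemma hw_psi_holder x y : x < 0 -> y < 0 ->
  `|psi x - psi y| ^+ 3 <= 24 * c ^+ 2 * (E + 1) * `|x - y|.
Proof.
move=> x0 y0; apply: le_trans (cube_dist_le _ _) _.
have : `|psi x ^+ 3 - psi y ^+ 3| <= 6 * c ^+ 2 * (E + 1) * `|x - y|; last lra.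
pose d z := 3 * psi z ^+ 2 * (expR (phi z) - c / u z).
apply: (@derive_norm_le _ (fun z => psi z ^+ 3) d) => // z z0.
  exact: is_derive_exp (hw_dpsi H z0).
have uz := u0 z0; have cu : 0 <= c / u z by rewrite divr_ge0 ?ltW.
have e : `|expR (phi z) - c / u z| <= E + c / u z.
  rewrite ler_norml; apply/andP; split.
    have := expR_ge0 (phi z); have : 0 <= E by rewrite addr_ge0// sqr_ge0.
    lra.
  by have := hw_phi_le0 z0; rewrite -ler_expR hw_energy0; lra.
have E0 : 0 <= E by rewrite addr_ge0// sqr_ge0.
rewrite /d normrM ger0_norm; last by rewrite mulr_ge0 ?sqr_ge0.
apply: le_trans (_ : 3 * (2 * c * u z) * (E + c / u z) <= _).
  apply: ler_pM => //; first by rewrite mulr_ge0 ?sqr_ge0.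
  by have := hw_psi_sqr_le_u z0; lra.
have -> : 3 * (2 * c * u z) * (E + c / u z) = 6 * c * (E * u z + c).
  by field; rewrite gt_eqF.
have -> : 6 * c ^+ 2 * (E + 1) = 6 * c * (E * c + c) by ring.
rewrite ler_wpM2l ?mulr_ge0 ?(ltW c0)//.
by rewrite lerD2r ler_wpM2l//; exact/ltW/uc.
Qed.

(** The logarithmic term is at most k c / u, and k = r^2 <= r u turns this into c r, which is small
    with k uniformly in x. *)
Lemma hw_phi_bounds x : x < 0 ->
  (c ^+ 2 - u x ^+ 2) / 2 - c * r <= phi x <= (c ^+ 2 - u x ^+ 2) / 2.
Proof.
move=> x0; have /andP[l1 l2] := hw_ln_bounds x0; rewrite (hw_phiE H)//.
suff : k * (c - u x) / u x <= c * r by lra.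
have uz := u0 x0; have kr := hw_k_ge0 H.
rewrite ler_pdivrMr//; apply: le_trans (_ : k * c <= _).
  by rewrite ler_wpM2l//; lra.
rewrite {1}kE expr2 mulrC -!mulrA ler_pM2l//.
by rewrite ler_wpM2l ?r0//; exact/ltW/ur.
Qed.

Lemma hw_phi0_bounds :
  (c ^+ 2 - k) / 2 - c * r <= phi 0 <= (c ^+ 2 - k) / 2.
Proof.
have l : (c ^+ 2 - u x ^+ 2) / 2 @[x --> 0^'-] --> (c ^+ 2 - r * r) / 2.
  apply: cvgMl; apply: cvgB; first exact: cvg_cst.
  by apply: cvgM; exact: hw_u_left0 H.
have m1 : (- 1 : R) < 0 by lra.
have ll : phi x - (c ^+ 2 - u x ^+ 2) / 2 @[x --> 0^'-] -->
    phi 0 - (c ^+ 2 - r * r) / 2 by apply: cvgB => //; exact: hw_phi_left0 H.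
have h1 := cvg_left_le (b := 0) m1 ll.
have h2 := cvg_left_ge (b := - (c * r)) m1 ll.
have {}h1 : phi 0 - (c ^+ 2 - r * r) / 2 <= 0.
  by apply: h1 => y _ /hw_phi_bounds; lra.
have {}h2 : - (c * r) <= phi 0 - (c ^+ 2 - r * r) / 2.
  by apply: h2 => y _ /hw_phi_bounds; lra.
by rewrite kE; lra.
Qed.

(** The value phi 0 is known in two ways, as ln (1 + (c - r)^2) from the energy at the peak and as
    (c^2 - k) / 2 up to c r from the formula for phi. *)
Lemma hw_speed_bounds :
  (c - r) ^+ 2 / 2 - k <= ln (1 + (c - r) ^+ 2) <= (c - r) ^+ 2 / 2 + (c - r) * r.
Proof.
by have := hw_phi0_bounds; rewrite -/E -hw_energy0 expRK kE; lra.
Qed.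

End OneWave.
End HalfWaveEstimates.

(** * Uniform convergence of the velocities *)

Section Comparison.
Variable R : realType.
Implicit Types a b d e k c x y z : R.

Lemma expR_dist_le a b e : a <= e -> b <= e ->
  `|expR a - expR b| <= expR e * `|a - b|.
Proof.
wlog ba : a b / b <= a => [hw ae be|ae _].
  have [ba|/ltW ab] := leP b a; first exact: hw.
  by rewrite distrC (distrC a); exact: hw.
rewrite !ger0_norm ?subr_ge0 ?ler_expR//.
apply: le_trans (_ : expR a * (a - b) <= _); last first.
  by rewrite ler_wpM2r ?subr_ge0// ler_expR.
have -> : expR b = expR a * expR (b - a) by rewrite -expRD addrC subrK.
have := expR_ge1Dx (b - a); have := expR_gt0 a; nra.
Qed.

Lemma ln_tangent_le a b : 0 < a -> 0 < b -> ln b <= ln a + (b - a) / a.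
Proof.
move=> a0 b0; have : ln (b / a) <= b / a - 1 by apply: ln_le_subr1; rewrite divr_gt0.
rewrite ln_div ?posrE// mulrBl divff ?gt_eqF//; lra.
Qed.

(** Let F(y) = y/2 - ln (1 + y), which is convex with minimum at 1 since F'(y) = (y - 1) / (2 (1 +
    y)). Then y0 is the root of F beyond 1, and the last hypothesis reads - t r <= F(t^2) <= r^2.
    The condition 1 - r <= t keeps t^2 away from the other root, 0. *)
Lemma speed_modulus y0 e : 1 < y0 -> ln (1 + y0) = y0 / 2 -> 0 < e ->
  exists2 d, 0 < d & forall r t : R, 0 <= r -> r <= d -> 1 - r <= t ->
    t ^+ 2 / 2 - r ^+ 2 <= ln (1 + t ^+ 2) <= t ^+ 2 / 2 + t * r ->
    `|t ^+ 2 - y0| <= e.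
Proof.
move=> y01 lny0 e0.
pose f : R := Num.min e ((y0 - 1) / 2).
have f0 : 0 < f by rewrite lt_min e0/=; lra.
have fe : f <= e by rewrite ge_min lexx.
have fy : f <= (y0 - 1) / 2 by rewrite ge_min lexx orbT.
pose y1 := y0 - f; have y11 : 1 < y1 by rewrite /y1; lra.
(* [b] is F'(y0) and [q] is f F'(y1). By convexity F(y) >= b (y - y0) above y0, whereas F(y1) <= -
   q, which excludes t^2 <= y1 once r is small. *)
pose b : R := (y0 - 1) / (2 * (1 + y0)).
have b0 : 0 < b by rewrite divr_gt0//; lra.
pose q : R := f * ((y1 - 1) / (2 * (1 + y1))).
have q0 : 0 < q by rewrite mulr_gt0// divr_gt0//; lra.
exists (Num.min (2^-1) (Num.min (b * e) (q / (4 * y0)))).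
  rewrite !lt_min mulr_gt0//= divr_gt0// ?andbT; lra.
move=> r t r0; rewrite !le_min => /and3P[r2 rb rq] rt /andP[tl tu].
have t0 : 0 < t by lra.
set y := t ^+ 2 in tl tu *; have y0' : 0 <= y by exact: sqr_ge0.
have rr : r ^+ 2 <= r by nra.
rewrite ler_norml; apply/andP; split; last first.
  have [yy|yy] := leP y y0; first lra.
  have : (y - y0) * b <= r ^+ 2.
    have := @ln_tangent_le (1 + y0) (1 + y) ltac:(lra) ltac:(lra).
    have -> : (1 + y - (1 + y0)) / (1 + y0) = (y - y0) * (1 / 2 - b).
      by rewrite /b; field; lra.
    rewrite lny0; lra.
  move=> h; have : (y - y0) * b <= e * b by lra.
  by rewrite ler_pM2r.
rewrite leNgt; apply/negP => ye.
have yy1 : y <= y1 by rewrite /y1; lra.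
have ty0 : t <= y0 by rewrite /y in yy1; rewrite /y1 in yy1; nra.
have q1 : q + y1 / 2 <= ln (1 + y1).
  have := @ln_tangent_le (1 + y1) (1 + y0) ltac:(lra) ltac:(lra).
  have -> : (1 + y0 - (1 + y1)) / (1 + y1) = f / 2 - q.
    by rewrite /q /y1; field; rewrite /y1 in y11; lra.
  rewrite lny0 /y1; lra.
have := @ln_tangent_le (1 + y) (1 + y1) ltac:(lra) ltac:(lra).
have -> : (1 + y1 - (1 + y)) / (1 + y) =
    (y1 - y) / 2 - (y1 - y) * ((y - 1) / (2 * (1 + y))) by field; lra.
move=> h.
(* That is, F'(y) >= - r: to the left of y1, F can exceed F(y1) by at most y1 r. *)
have yr : - r <= (y - 1) / (2 * (1 + y)).
  rewrite ler_pdivlMr; last by lra.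
  have : 1 - 2 * r <= y by rewrite /y; nra.
  nra.
have h2 : - (y1 * r) <= (y1 - y) * ((y - 1) / (2 * (1 + y))).
  move: yr; move: (_ / (2 * (1 + y))) => g gr.
  apply: le_trans (_ : (y1 - y) * - r <= _); first nra.
  by rewrite ler_wpM2l//; lra.
have h3 : t * r <= y0 * r by rewrite ler_wpM2r.
have h4 : y1 * r <= y0 * r by rewrite ler_wpM2r// /y1; lra.
have h5 : r * (4 * y0) <= q by rewrite -ler_pdivlMr//; lra.
lra.
Qed.

Lemma hw_c_gt1 k c (u phi psi : R -> R) : half_wave k c u phi psi -> 1 < c.
Proof.
move=> H; have := hw_c_sqr_gt H; have := hw_k_ge0 H; have := hw_c_gt0 H; nra.
Qed.

Lemma hw_speed_cvg c0 (u0 phi0 psi0 : R -> R) e :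
  half_wave 0 c0 u0 phi0 psi0 -> 0 < e ->
  exists2 d, 0 < d & forall k c (u phi psi : R -> R),
    half_wave k c u phi psi -> Num.sqrt k <= d -> `|c - c0| <= e.
Proof.
move=> H0 e0; have c01 := hw_c_gt1 H0.
have := hw_speed_bounds H0; rewrite sqrtr0 !subr0 => /andP[b1 b2].
have [|||d d0 hd] := @speed_modulus (c0 ^+ 2) (e / 2); [by nra| |lra|].
  by lra.
exists (Num.min d (e / 2)); first by rewrite lt_min d0/=; lra.
move=> k c u phi psi H; rewrite le_min => /andP[kd ke].
have r0 := sqrtr_ge0 k; have c1 := hw_c_gt1 H; have rc := hw_c_gt H.
have := hd _ (c - Num.sqrt k) r0 kd; rewrite (sqr_sqrtr (hw_k_ge0 H)).
move=> /(_ _ (hw_speed_bounds H)) h.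
have {}h : `|(c - Num.sqrt k) ^+ 2 - c0 ^+ 2| <= e / 2 by apply: h; lra.
have h2 : `|c - Num.sqrt k - c0| <= e / 2.
  apply: le_trans h; rewrite subr_sqr normrM ler_peMr//.
  rewrite ger0_norm; lra.
by move: h2; rewrite !ler_norml => /andP[? ?]; apply/andP; split; lra.
Qed.

Section TwoWaves.
Variables (k c c0 : R) (u phi psi u0 phi0 psi0 : R -> R).
Hypothesis H : half_wave k c u phi psi.
Hypothesis H0 : half_wave 0 c0 u0 phi0 psi0.
Let r : R := Num.sqrt k.
Let B : R := c0 + 1.
Hypothesis cc0 : `|c - c0| <= 1.
Variables x y : R.
Hypotheses (x0 : x < 0) (y0 : y < 0).
(** The waves are compared at two points: x = y for uniform convergence, and points with u x = u0 y
    for the inverse functions, where [d] reduces to the distance of the parameters. *)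
Let d : R := r + `|c - c0| + `|u x - u0 y|.

Let r0 : 0 <= r. Proof. exact: sqrtr_ge0. Qed.
Let cB : c <= B. Proof. by move: cc0; rewrite ler_norml /B; lra. Qed.
Let rd : r <= d. Proof. by rewrite /d -addrA lerDl addr_ge0. Qed.
Let cd : `|c - c0| <= d.
Proof. by rewrite /d addrAC lerDr addr_ge0// r0. Qed.
Let ud : `|u x - u0 y| <= d. Proof. by rewrite /d lerDr addr_ge0// r0. Qed.

Lemma hw_phi_close : `|phi x - phi0 y| <= 3 * B * d.
Proof.
have /andP[p1 p2] := hw_phi_bounds H x0.
have /andP[q1 q2] := hw_phi_bounds H0 y0.
rewrite sqrtr0 mulr0 subr0 in q1.
have c1 := hw_c_gt0 H; have c01 := hw_c_gt0 H0.
have h1 : `|c ^+ 2 - c0 ^+ 2| <= d * (2 * B).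
  rewrite subr_sqr normrM ler_pM// ger0_norm; have := cB; rewrite /B; lra.
have h2 : `|u x ^+ 2 - u0 y ^+ 2| <= d * (2 * B).
  have ? := hw_u_gt0 H x0; have ? := hw_u_gt0 H0 y0.
  have ? := hw_u_lt H x0; have ? := hw_u_lt H0 y0.
  rewrite subr_sqr normrM ler_pM// ger0_norm; have := cB; rewrite /B; lra.
have h3 : c * r <= B * d by rewrite ler_pM ?r0 ?cB ?rd// ltW.
move: h1 h2; rewrite !ler_norml -/r in p1 * => /andP[? ?] /andP[? ?].
have d0 : 0 <= B * d by apply: le_trans h3; rewrite mulr_ge0 ?r0// ltW.
apply/andP; split; lra.
Qed.

Lemma hw_psi_sqr_close :
  `|psi x ^+ 2 - psi0 y ^+ 2| <= 6 * B * (3 + expR (B ^+ 2 / 2)) * d.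
Proof.
have c1 := hw_c_gt0 H; have c01 := hw_c_gt0 H0; have rc := hw_c_gt H.
have u1 := hw_u_gt0 H x0; have u01 := hw_u_gt0 H0 y0.
have uc := hw_u_lt H x0; have u0c := hw_u_lt H0 y0.
have ur := hw_u_gt H x0; rewrite -/r in ur rc.
have B0 : 0 < B by rewrite /B; lra.
have d0 : 0 <= d by apply: le_trans r0 rd.
have := hw_energy H0 y0; have := hw_energy H x0; rewrite -/r sqrtr0 !subr0.
have -> : c0 * u0 y ^+ 2 / u0 y = c0 * u0 y by field; rewrite gt_eqF.
(* After this expansion 1 / u occurs only in r^2 / u, which is at most r. *)
have -> : c * (u x - r) ^+ 2 / u x = c * u x - 2 * c * r + c * (r ^+ 2 / u x).
  by field; rewrite gt_eqF.
move=> e1 e2.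
have h1 : 0 <= c * (r ^+ 2 / u x) <= B * d.
  rewrite mulr_ge0 ?divr_ge0 ?sqr_ge0 ?(ltW c1) ?(ltW u1)//=.
  apply: ler_pM; rewrite ?divr_ge0 ?sqr_ge0 ?(ltW c1) ?(ltW u1) ?cB//.
  apply: le_trans rd; rewrite ler_pdivrMr// expr2.
  by apply: ler_wpM2l; [exact: r0|exact: ltW].
have h2 : 0 <= c * r <= B * d.
  by rewrite mulr_ge0 ?r0 ?(ltW c1)//= ler_pM ?r0 ?cB ?rd// ltW.
have h3 : `|c * u x - c0 * u0 y| <= 2 * (B * d).
  have -> : c * u x - c0 * u0 y = (c - c0) * u x + c0 * (u x - u0 y) by ring.
  apply: le_trans (ler_normD _ _) _; rewrite !normrM (ger0_norm (ltW u1)).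
  rewrite (ger0_norm (ltW c01)).
  have : `|c - c0| * u x <= d * B by rewrite ler_pM ?(ltW u1) ?cd//; have := cB; lra.
  have : c0 * `|u x - u0 y| <= B * d.
    by rewrite ler_pM ?(ltW c01) ?ud// /B; lra.
  lra.
have h4 : `|(c - r) ^+ 2 - c0 ^+ 2| <= 2 * d * (2 * B).
  rewrite subr_sqr normrM ler_pM//.
    have := cd; have := rd; have := r0; rewrite !ler_norml => ? ? /andP[? ?].
    by apply/andP; split; lra.
  by rewrite ger0_norm; have := cB; have := r0; rewrite /B; lra.
have h5 : `|expR (phi x) - expR (phi0 y)| <= expR (B ^+ 2 / 2) * (3 * B * d).
  apply: le_trans (ler_wpM2l (expR_ge0 _) hw_phi_close).
  have := cB; rewrite /B => cB'.
  apply: expR_dist_le.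
    by have /andP[_] := hw_phi_bounds H x0; nra.
  by have /andP[_] := hw_phi_bounds H0 y0; nra.
move: h1 h2 h3 h4 h5; rewrite !ler_norml.
move: (expR (B ^+ 2 / 2)) => M.
move=> /andP[? ?] /andP[? ?] /andP[? ?] /andP[? ?] /andP[? ?].
apply/andP; split; lra.
Qed.

End TwoWaves.
End Comparison.

(** * Comparison of two waves through their inverse functions *)

Section InverseComparison.
Variable R : realType.
Implicit Types (d e k c s t x y z p q m r eta tau : R) (u phi psi : R -> R).

Lemma hw_surjective k c u phi psi s : half_wave k c u phi psi ->
  Num.sqrt k < s -> s < c -> exists2 x, x < 0 & u x = s.
Proof.
move=> H ks sc.
have [a [a0 as_]] : exists a, a < 0 /\ s < u a.
  have [M [_ HM]] : \forall y \near -oo, s < u y by apply: (cvgr_gt _ (hw_u_Ny H)).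
  exists (Num.min M 0 - 1); split.
    by rewrite ltrBlDr gt_min add0r ltr01 orbT.
  by apply: HM; have : Num.min M 0 <= M by [rewrite ge_min lexx]; lra.
have [b [ab b0 bs]] : exists b, [/\ a < b, b < 0 & u b < s].
  near (0 : R)^'- => b; exists b; split.
  - by near: b; exact: nbhs_left_gt.
  - by near: b; exact: nbhs_left_lt.
  - by near: b; apply: (cvgr_lt _ (hw_u_left0 H)).
have [||x] := @IVT R u a b s (ltW ab).
- apply: derivable_within_continuous => t; rewrite in_itv /= => /andP[_ tb].
  by have [] := hw_du H (le_lt_trans tb b0).
- by rewrite ge_min le_max (ltW bs) (ltW as_) orbT.
by rewrite in_itv /= => /andP[_ xb] us; exists x => //; exact: le_lt_trans xb b0.
Unshelve. all: by end_near. Qed.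

Lemma hw_u_inj k c u phi psi x y : half_wave k c u phi psi ->
  x < 0 -> y < 0 -> u x = u y -> x = y.
Proof.
move=> H x0 y0 e; have [xy|yx|//] := ltgtP x y.
  by have := hw_u_decreasing H xy y0; rewrite e ltxx.
by have := hw_u_decreasing H yx x0; rewrite e ltxx.
Qed.

Lemma hw_inverse k c u phi psi : half_wave k c u phi psi ->
  exists X : R -> R, forall s, Num.sqrt k < s -> s < c ->
    [/\ X s < 0, u (X s) = s &
        is_derive s 1 X (- (psi (X s) * s / (s ^+ 2 - k)))^-1].
Proof.
move=> H; pose X s := xget 0 [set x | x < 0 /\ u x = s].
have Xu x : x < 0 -> X (u x) = x.
  move=> x0; rewrite /X; case: xgetP => [y _ [y0 yx]|/(_ x)[]//].
  exact: (hw_u_inj H y0 x0 yx).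
exists X => s ks sc; have [x x0 us] := hw_surjective H ks sc.
rewrite -us Xu//; split => //.
have near_lt0 : \forall t \near x, t < 0 by exact: lt_nbhsl.
apply: is_derive_inverse (hw_du H x0) _.
- by near=> t; apply: Xu; near: t.
- near=> t; have t0 : t < 0 by near: t.
  exact: is_derive_continuous (hw_du H t0).
- rewrite oppr_eq0 gt_eqF// divr_gt0 ?mulr_gt0 ?(hw_psi_gt0 H) ?(hw_u_gt0 H)//.
  exact: (hw_u2k_gt0 H x0).
Unshelve. all: by end_near. Qed.

(** A coarse linear form of [hw_u_lower], using u <= 1 < c. It places points of low level near 0,
    under a condition that depends on the speed only through [B]. *)
Lemma hw_near0 k c u phi psi B x : half_wave k c u phi psi -> c <= B -> x < 0 ->
  2 * (1 + B ^+ 2) * u x <= 1 -> - x <= 4 / 3 * u x.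
Proof.
move=> H cB x0 uB; have c1 := hw_c_gt1 H; have ux := hw_u_gt0 H x0.
have rc := hw_c_gt H; have r0 := sqrtr_ge0 k.
have uE : 2 * (1 + (c - Num.sqrt k) ^+ 2) * u x <= c.
  apply: le_trans (le_trans uB (ltW c1)); rewrite ler_wpM2r ?(ltW ux)//; nra.
have := hw_u_lower H x0 uE.
have u1 : u x <= 1 by nra.
have su : Num.sqrt (u x) <= 1 by rewrite -sqrtr1 ler_wsqrtr.
have sc : 1 <= Num.sqrt c by rewrite -[leLHS]sqrtr1 ler_wsqrtr// ltW.
have : u x * Num.sqrt (u x) <= u x by rewrite ler_piMr// ltW.
have : - x <= Num.sqrt c * - x by rewrite ler_peMl// oppr_ge0 ltW.
lra.
Qed.

(** The difference equals t (p - q) / (p q) + k / (t p), where k / t <= r. The factor 3/4 leaves p^2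
    >= m^2 / 4, so only the limit slope q needs a lower bound beforehand. *)
Lemma inverse_speed_dist p q m K d t k r B : 0 < m -> m <= q -> 0 < p ->
  0 <= K -> 0 <= d -> `|p ^+ 2 - q ^+ 2| <= K * d -> K * d <= 3 / 4 * m ^+ 2 ->
  k = r ^+ 2 -> 0 <= r -> r < t -> t <= B -> r <= d ->
  `|(- (p * t / (t ^+ 2 - k)))^-1 - (- (q * t / (t ^+ 2 - 0)))^-1|
    <= (2 * B * K / m ^+ 3 + 2 / m) * d.
Proof.
move=> m0 mq p0 K0 d0 pq Kd kr r0 rt tB rd.
have q0 : 0 < q by lra.
have t0 : 0 < t by lra.
have B0 : 0 < B by lra.
have tk : 0 < t ^+ 2 - k by rewrite kr; nra.
have pm : m / 2 <= p.
  rewrite -(ler_pXn2r (n := 2)) ?nnegrE; [|done|lra|lra].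
  have : m ^+ 2 <= q ^+ 2 by rewrite ler_pXn2r ?nnegrE; [done|done|lra|lra].
  by move: pq; rewrite ler_norml => /andP[? ?] ?; lra.
have -> : (- (p * t / (t ^+ 2 - k)))^-1 - (- (q * t / (t ^+ 2 - 0)))^-1 =
    t * (p - q) / (p * q) + k / t / p.
  by field; rewrite !gt_eqF// !mulr_gt0.
have pq' : `|p - q| <= K * d / m.
  rewrite ler_pdivlMr//; apply: le_trans pq; rewrite subr_sqr normrM.
  by rewrite ler_wpM2l// ger0_norm; lra.
apply: le_trans (ler_normD _ _) _; rewrite mulrDl lerD//.
  rewrite normrM normfV normrM (gtr0_norm t0) (gtr0_norm (mulr_gt0 p0 q0)).
  rewrite ler_pdivrMr ?mulr_gt0//.
  apply: le_trans (_ : B * (K * d / m) <= _).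
    by rewrite ler_pM// ltW.
  have -> : B * (K * d / m) = 2 * B * K / m ^+ 3 * d * (m / 2 * m).
    by field; rewrite gt_eqF.
  rewrite ler_wpM2l//; first by rewrite !mulr_ge0// ?invr_ge0 ?exprn_ge0// ltW.
  by rewrite ler_pM//; lra.
rewrite ger0_norm; last by rewrite !mulr_ge0 ?invr_ge0 ?kr ?sqr_ge0// ltW.
rewrite ler_pdivrMr// ler_pdivrMr//.
have -> : 2 / m * d * p * t = (2 * p / m) * (d * t) by field; rewrite gt_eqF.
apply: le_trans (_ : d * t <= _).
  by rewrite kr expr2 ler_pM//; lra.
rewrite ler_peMl ?mulr_ge0//; first lra.
by rewrite ler_pdivlMr//; lra.
Qed.

Lemma derive_norm_le_itv (f df : R -> R) (a b M : R) : a <= b ->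
  (forall t, a <= t -> t <= b -> is_derive t 1 f (df t)) ->
  (forall t, a <= t -> t <= b -> `|df t| <= M) ->
  `|f b| <= `|f a| + M * (b - a).
Proof.
move=> ab fdf dfM; have [||t] := @MVT_segment R f df a b ab.
- by move=> t; rewrite in_itv /= => /andP[/ltW at_ /ltW tb]; exact: fdf.
- apply: derivable_within_continuous => t; rewrite in_itv /= => /andP[at_ tb].
  by have [] := fdf t at_ tb.
rewrite in_itv /= => /andP[at_ tb] e.
have -> : f b = f a + df t * (b - a) by rewrite -e addrC subrK.
apply: le_trans (ler_normD _ _) _; rewrite lerD2l normrM (@ger0_norm _ (b - a)) ?subr_ge0//.
by rewrite ler_wpM2r ?subr_ge0// dfM.
Qed.

Section Limit.
Variables (c0 : R) (u0 phi0 psi0 : R -> R).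
Hypothesis H0 : half_wave 0 c0 u0 phi0 psi0.
Let B : R := c0 + 1.

Lemma hw_inverse_close eta tau : 0 < eta -> eta < c0 -> 0 < tau ->
  exists2 d, 0 < d & forall k c u phi psi, half_wave k c u phi psi ->
    Num.sqrt k + `|c - c0| <= d ->
    forall x y, x < 0 -> y < 0 -> u x = u0 y -> u x <= c0 - eta ->
    `|x - y| <= tau.
Proof.
move=> eta0 etac tau0; have c01 := hw_c_gt1 H0.
pose b : R := c0 - eta; have b0 : 0 < b by rewrite /b; lra.
have B2 : 0 < 2 * (1 + B ^+ 2) by rewrite mulr_gt0// ltr_wpDr ?sqr_ge0.
(* Level below which both points lie in [- tau / 3, 0[: 4/3 times tau / 4 is tau / 3, and the last
   entry makes [hw_near0] applicable. The first entry keeps e < b. *)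
pose e : R := Num.min (b / 2) (Num.min (tau / 4) (2 * (1 + B ^+ 2))^-1).
have e0 : 0 < e by rewrite !lt_min invr_gt0 B2 !divr_gt0.
have eb : e < b by rewrite /e gt_min; apply/orP; left; lra.
have et : e <= tau / 4 by rewrite /e !ge_min lexx orbT.
have eB : 2 * (1 + B ^+ 2) * e <= 1.
  by rewrite mulrC -ler_pdivlMr// mul1r /e !ge_min lexx !orbT.
clearbody e.
have [ye ye0 uye] : exists2 y : R, y < 0 & u0 y = e.
  by apply: (hw_surjective H0); rewrite ?sqrtr0//; rewrite /b in eb; lra.
have [yb yb0 uyb] : exists2 y : R, y < 0 & u0 y = b.
  by apply: (hw_surjective H0); rewrite ?sqrtr0// /b; lra.
have ybe : yb < ye.
  rewrite ltNge; apply/negP => h; have : u0 yb <= u0 ye.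
    move: h; rewrite le_eqVlt => /predU1P[->//|h].
    exact/ltW/(hw_u_decreasing H0).
  by rewrite uye uyb leNgt eb.
(* Compactness of the range of levels [e, b] bounds psi0 below by some m > 0. *)
have [|z zI zmin] := @EVT_min R psi0 yb ye (ltW ybe).
  apply: derivable_within_continuous => t.
  rewrite in_itv /= => /andP[_ tb].
  by have [] := hw_dpsi H0 (le_lt_trans tb ye0).
pose m := psi0 z.
have m0 : 0 < m.
  apply: (hw_psi_gt0 H0); move: zI; rewrite in_itv /= => /andP[_ zy].
  exact: le_lt_trans zy ye0.
pose K : R := 6 * B * (3 + expR (B ^+ 2 / 2)).
have K0 : 0 < K.
  by rewrite /K !mulr_gt0// ?addr_gt0 ?expR_gt0// /B; lra.
pose C : R := 2 * B * K / m ^+ 3 + 2 / m.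
have C0 : 0 < C.
  by rewrite addr_gt0 ?divr_gt0 ?mulr_gt0 ?exprn_gt0// /B; lra.
have CB : 0 < C * B by rewrite mulr_gt0// /B; lra.
(* In order: |c - c0| <= 1, the level b stays below c, sqrt k stays below e, the slopes psi stay
   above m / 2, and the integrated difference is at most tau / 3. *)
exists (Num.min (Num.min 1 (eta / 2)) (Num.min (e / 2)
   (Num.min (3 / 4 * m ^+ 2 / K) (tau / 3 / (C * B))))).
  have hm : 0 < 3 / 4 * m ^+ 2 / K by rewrite divr_gt0// mulr_gt0 ?exprn_gt0.
  have ht : 0 < tau / 3 / (C * B) by rewrite divr_gt0// divr_gt0.
  rewrite !lt_min ltr01 hm ht /= andbT; apply/andP; split; lra.
move=> k c u phi psi H; rewrite !le_min; set d : R := Num.sqrt k + _.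
move=> /andP[/andP[d1 deta] /and3P[de dK dC]] x y x0 y0 uxy.
have r0 := sqrtr_ge0 k.
have d0 : 0 <= d by rewrite addr_ge0.
have rd : Num.sqrt k <= d by rewrite lerDl.
have cd : `|c - c0| <= d by rewrite lerDr.
have cc0 : `|c - c0| <= 1 by lra.
have cB : c <= B by move: cc0; rewrite ler_norml /B; lra.
have cb : b < c by move: cd; rewrite ler_norml /b => /andP[? _]; lra.
rewrite -/b => ub.
have small x' y' : x' < 0 -> y' < 0 -> u x' = u0 y' -> u x' <= e -> `|x' - y'| <= tau / 3.
  move=> x'0 y'0 e' ux'.
  have c0B : c0 <= B by rewrite /B; lra.
  have := hw_near0 H cB x'0; have := hw_near0 H0 c0B y'0.
  rewrite -e'; have h : 2 * (1 + B ^+ 2) * u x' <= 1.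
    by apply: le_trans eB; rewrite ler_wpM2l// ltW.
  by move=> /(_ h) h1 /(_ h) h2; rewrite ler_norml; apply/andP; split; lra.
have [/(small _ _ x0 y0 uxy)|eu] := leP (u x) e; first lra.
have [X HX] := hw_inverse H; have [Y HY] := hw_inverse H0.
rewrite sqrtr0 in HY.
have re : Num.sqrt k < e by lra.
have bc0 : b < c0 by rewrite /b; lra.
have HXs s : e <= s -> s <= b -> [/\ X s < 0, u (X s) = s &
    is_derive s 1 X (- (psi (X s) * s / (s ^+ 2 - k)))^-1].
  by move=> es sb; apply: HX; lra.
have HYs s : e <= s -> s <= b -> [/\ Y s < 0, u0 (Y s) = s &
    is_derive s 1 Y (- (psi0 (Y s) * s / (s ^+ 2 - 0)))^-1].
  by move=> es sb; apply: HY; lra.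
pose D s := X s - Y s.
pose D' s : R := (- (psi (X s) * s / (s ^+ 2 - k)))^-1
              - (- (psi0 (Y s) * s / (s ^+ 2 - 0)))^-1.
have dD s : e <= s -> s <= b -> is_derive s 1 D (D' s).
  move=> es sb; have [_ _ h1] := HXs s es sb; have [_ _ h2] := HYs s es sb.
  exact: is_derive_add h1 (is_derive_opp h2).
have D'le s : e <= s -> s <= b -> `|D' s| <= C * d.
  move=> es sb; have [Xs0 uX _] := HXs s es sb; have [Ys0 uY _] := HYs s es sb.
  apply: (@inverse_speed_dist _ _ m K d s k (Num.sqrt k) B) => //.
  - apply: zmin; rewrite in_itv /=; apply/andP; split; rewrite leNgt; apply/negP => h.
      by have := hw_u_decreasing H0 h yb0; rewrite uY uyb; lra.
    by have := hw_u_decreasing H0 h Ys0; rewrite uY uye; lra.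
  - exact: hw_psi_gt0 H _ Xs0.
  - exact: ltW.
  - have := hw_psi_sqr_close H H0 cc0 Xs0 Ys0.
    by rewrite uX uY subrr normr0 addr0.
  - by rewrite mulrC -ler_pdivlMr.
  - by rewrite sqr_sqrtr// (hw_k_ge0 H).
  - lra.
  - by rewrite /b in bc0 sb; rewrite /B; lra.
have [Xe0 uXe _] := HXs e (lexx e) (ltW eb).
have [Ye0 uYe _] := HYs e (lexx e) (ltW eb).
have De : `|D e| <= tau / 3 by apply: small; rewrite ?uXe ?uYe.
have -> : x - y = D (u x).
  have [Xx0 uXx _] := HXs (u x) (ltW eu) ub.
  have [Yx0 uYx _] := HYs (u x) (ltW eu) ub.
  rewrite /D (hw_u_inj H Xx0 x0 uXx) (hw_u_inj H0 Yx0 y0)//.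
  by rewrite uYx.
apply: le_trans (derive_norm_le_itv (M := C * d) (ltW eu) _ _) _.
- by move=> t et' tu; apply: dD => //; exact: le_trans tu ub.
- by move=> t et' tu; apply: D'le => //; exact: le_trans tu ub.
have : C * d * (u x - e) <= tau / 3; last lra.
apply: le_trans (_ : C * d * B <= _); last by rewrite mulrAC -ler_pdivlMl// mulrC.
rewrite ler_wpM2l//; first by rewrite mulr_ge0// ltW.
by rewrite /b in ub; rewrite /B; lra.
Qed.

(** If u x = u0 y with |x - y| small, then u x - u0 x = u0 y - u0 x is controlled by the Hoelder
    modulus of the limit wave alone. *)
Lemma hw_u_close e : 0 < e ->
  exists2 d, 0 < d & forall k c u phi psi, half_wave k c u phi psi ->
    Num.sqrt k + `|c - c0| <= d -> forall x, x < 0 -> `|u x - u0 x| <= e.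
Proof.
move=> e0; have c01 := hw_c_gt1 H0.
pose eta : R := Num.min (e / 4) (c0 / 2).
have eta0 : 0 < eta by rewrite lt_min; apply/andP; split; lra.
have etac : eta < c0 by rewrite /eta gt_min; apply/orP; right; lra.
have etah : eta <= c0 / 2 by rewrite /eta ge_min lexx orbT.
have etae : eta <= e / 4 by rewrite /eta ge_min lexx.
(* For |x - y| <= min(1, M) the square in [hw_u_holder] is at most |x - y|, and the bound becomes (e
   / 4)^3. *)
pose M : R := (e / 4) ^+ 3 / (9 / 2 * c0).
have M0 : 0 < M by rewrite divr_gt0 ?exprn_gt0 ?mulr_gt0//; lra.
pose tau := Num.min 1 M.
have tau0 : 0 < tau by rewrite lt_min ltr01.
have uc x y : x < 0 -> y < 0 -> `|x - y| <= tau -> `|u0 x - u0 y| <= e / 4.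
  move=> x0 y0 xy; rewrite -(ler_pXn2r (n := 3)) ?nnegrE//; last lra.
  apply: le_trans (hw_u_holder H0 x0 y0) _.
  rewrite mulrC -ler_pdivlMr ?mulr_gt0//; last lra.
  apply: le_trans (_ : `|x - y| <= _).
    rewrite expr2 ler_piMr//; apply: le_trans xy _.
    by rewrite /tau ge_min lexx.
  by apply: le_trans xy _; rewrite /tau ge_min lexx orbT.
have [d d0 hd] := hw_inverse_close eta0 etac tau0.
exists (Num.min (Num.min d (eta / 2)) (e / 4)).
  by rewrite !lt_min d0 !divr_gt0.
move=> k c u phi psi H; rewrite !le_min => /andP[/andP[dd deta] de] x x0.
have r0 := sqrtr_ge0 k.
have cc0 := normr_ge0 (c - c0).
have /andP[cl cu] : c0 - eta / 2 <= c <= c0 + e / 4.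
  have : `|c - c0| <= Num.min (eta / 2) (e / 4) by rewrite le_min; apply/andP; split; lra.
  by rewrite le_min !ler_norml => /andP[/andP[? ?] /andP[? ?]]; apply/andP; split; lra.
have [uxe|uxe] := leP (u x) (c0 - eta).
  have [||y y0 uy] := hw_surjective H0 (s := u x).
  - by rewrite sqrtr0; exact: hw_u_gt0 H _ x0.
  - by lra.
  apply: le_trans (_ : e / 4 <= _); last by lra.
  rewrite -uy; apply: uc => //; rewrite distrC; exact: hd H dd _ _ x0 y0 _ _.
(* Levels above c0 - eta: x lies to the left of the point z of level c0 - eta, so u0 x > u0 z by
   monotonicity, and u0 z is within e / 4 of c0 - eta. Both u x and u0 x are then squeezed near
   c0. *)
have [||z z0 uz] := hw_surjective H (s := c0 - eta); [lra|lra|].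
have [||y y0 uy] := hw_surjective H0 (s := c0 - eta); [by rewrite sqrtr0; lra|lra|].
have zy : `|z - y| <= tau by apply: hd H dd _ _ z0 y0 _ _; rewrite ?uz ?uy.
have xz : x < z.
  rewrite ltNge; apply/negP; rewrite le_eqVlt => /predU1P[zx|zx].
    by move: uxe; rewrite -zx uz ltxx.
  by have := hw_u_decreasing H zx x0; lra.
have := hw_u_decreasing H0 xz z0; have := uc _ _ z0 y0 zy; rewrite uy.
have := hw_u_lt H x0; have := hw_u_lt H0 x0.
rewrite !ler_norml => ? ? /andP[? ?] ?.
by apply/andP; split; lra.
Qed.

End Limit.
End InverseComparison.

(** * Hoelder norms *)

Section HolderNorms.
Variable R : realType.
Implicit Types (A S a b e x y : R) (f g : R -> R).

Lemma cube_add_le a b : 0 <= a -> 0 <= b ->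
  (a + b) ^+ 3 <= 4 * (a ^+ 3 + b ^+ 3).
Proof.
move=> a0 b0; rewrite -subr_ge0.
have -> : 4 * (a ^+ 3 + b ^+ 3) - (a + b) ^+ 3 = 3 * ((a + b) * (a - b) ^+ 2) by ring.
by rewrite mulr_ge0// mulr_ge0 ?sqr_ge0// addr_ge0.
Qed.

Lemma cube_dist_diff_le f g A B (n : nat) x y :
  `|f x - f y| ^+ 3 <= A * `|x - y| ^+ n ->
  `|g x - g y| ^+ 3 <= B * `|x - y| ^+ n ->
  `|(f \- g) x - (f \- g) y| ^+ 3 <= 4 * (A + B) * `|x - y| ^+ n.
Proof.
move=> fA gB.
have -> : (f \- g) x - (f \- g) y = (f x - f y) - (g x - g y) by rewrite /=; ring.
apply: le_trans (_ : (`|f x - f y| + `|g x - g y|) ^+ 3 <= _).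
  by rewrite ler_pXn2r ?nnegrE ?addr_ge0// ler_normB.
by apply: le_trans (cube_add_le _ _) _ => //; lra.
Qed.

(** Interpolation: with D = |f x - f y|, write D = (D^3)^(b/n) D^(1 - 3 b / n). The first factor
    gives |x - y|^b, the second a power of S, positive because 3 b < n. *)
Lemma holder_norm_le f (n : nat) b A S : (0 < n)%N -> 0 < b -> 3 * b < n%:R ->
  0 <= A -> (forall x, `|f x| <= S) ->
  (forall x y, `|f x - f y| ^+ 3 <= A * `|x - y| ^+ n) ->
  (holder_norm b f <=
    (S + A `^ (b / n%:R) * (2 * S) `^ (1 - 3 * b / n%:R))%:E)%E.
Proof.
move=> n0 b0 bn A0 fS fA; rewrite EFinD; apply: leeD.
  by apply: ge_ereal_sup => _ [x _ <-]; rewrite lee_fin.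
apply: ge_ereal_sup => _ [[x y] /= xy <-]; rewrite lee_fin.
have nR : 0 < n%:R :> R by rewrite ltr0n.
have t0 : 0 < `|x - y| by rewrite normr_gt0 subr_eq0.
rewrite ler_pdivrMr ?powR_gt0//.
have th1 : 0 <= 1 - 3 * b / n%:R by rewrite subr_ge0 ler_pdivrMr ?mul1r// ltW.
have -> : `|f x - f y| = (`|f x - f y| ^+ 3) `^ (b / n%:R) *
    `|f x - f y| `^ (1 - 3 * b / n%:R).
  have [->|D0] := eqVneq (`|f x - f y|) 0.
    by rewrite expr0n/= powR0 ?mul0r// mulf_neq0 ?invr_eq0 ?gt_eqF.
  rewrite -powR_mulrn// -powRrM -powRD ?D0 ?implybT//.
  have -> : 3%:R * (b / n%:R) + (1 - 3 * b / n%:R) = 1 :> R by ring.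
  by rewrite powRr1.
rewrite [leRHS]mulrAC; apply: ler_pM; rewrite ?powR_ge0//.
  have -> : A `^ (b / n%:R) * `|x - y| `^ b = (A * `|x - y| ^+ n) `^ (b / n%:R).
    rewrite powRM ?exprn_ge0// -powR_mulrn// -powRrM mulrCA divff ?mulr1//.
    by rewrite gt_eqF.
  apply: ge0_ler_powR; rewrite ?nnegrE ?exprn_ge0 ?mulr_ge0 ?exprn_ge0//.
  exact: ltW.
apply: ge0_ler_powR; rewrite ?nnegrE//.
  by rewrite mulr_ge0// (le_trans _ (fS x)).
by apply: le_trans (ler_normB _ _) _; have := fS x; have := fS y; lra.
Qed.

Lemma holder_bound_small (n : nat) b A e : (0 < n)%N -> 0 < b -> 3 * b < n%:R ->
  0 < e -> exists2 S, 0 < S & S + A `^ (b / n%:R) * (2 * S) `^ (1 - 3 * b / n%:R) <= e.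
Proof.
move=> n0 b0 bn e0.
have nR : 0 < n%:R :> R by rewrite ltr0n.
set th := 1 - _; have th0 : 0 < th by rewrite subr_gt0 ltr_pdivrMr ?mul1r.
set A' := A `^ _; have A'0 : 0 <= A' by exact: powR_ge0.
pose q : R := e / (2 * (A' + 1)); have q0 : 0 < q by rewrite divr_gt0// mulr_gt0// ltr_wpDl.
exists (Num.min (e / 2) (q `^ th^-1 / 2)).
  by rewrite lt_min !divr_gt0 ?powR_gt0.
set S := Num.min _ _.
have Se : S <= e / 2 by rewrite /S ge_min lexx.
have Sq : 2 * S <= q `^ th^-1 by rewrite mulrC -ler_pdivlMr// /S ge_min lexx orbT.
have S0 : 0 < S by rewrite lt_min !divr_gt0 ?powR_gt0.
have : (2 * S) `^ th <= q.
  apply: (@le_trans _ _ ((q `^ th^-1) `^ th)).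
    by apply: ge0_ler_powR; rewrite ?nnegrE ?powR_ge0 ?mulr_ge0 ?(ltW S0) ?(ltW th0).
  by rewrite -powRrM mulVf ?gt_eqF// powRr1// ltW.
move=> h; have : A' * (2 * S) `^ th <= A' * q by rewrite ler_wpM2l.
have : (A' + 1) * q = e / 2 by rewrite /q; field; rewrite gt_eqF// ltr_wpDl.
lra.
Qed.

Lemma cvge0_near_le (T : Type) (F : set_system T) {FF : ProperFilter F} (N : T -> \bar R) :
  (forall t, 0 <= N t)%E ->
  (forall e, 0 < e -> \forall t \near F, (N t <= e%:E)%E) -> N t @[t --> F] --> 0%E.
Proof.
move=> N0 Ne; apply/fine_cvgP; split.
  by apply: filterS (Ne 1 ltr01) => t Nt; rewrite ge0_fin_numE// (le_lt_trans Nt) ?ltry.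
apply/cvgrPdist_le => e e0; apply: filterS (Ne e e0) => t Nt /=.
rewrite sub0r normrN ger0_norm ?fine_ge0//.
by rewrite -lee_fin fineK// ge0_fin_numE// (le_lt_trans Nt) ?ltry.
Qed.

Lemma sup_norm_ge0 f : (0 <= sup_norm f)%E.
Proof.
apply: (@le_trans _ _ (`|f 0|%:E)); first by rewrite lee_fin.
by apply: ereal_sup_ubound; exists 0.
Qed.

Lemma holder_norm_ge0 b f : (0 <= holder_norm b f)%E.
Proof.
rewrite adde_ge0 ?sup_norm_ge0//.
apply: (@le_trans _ _ (`|f 1 - f 0| / `|1 - 0| `^ b)%:E).
  by rewrite lee_fin divr_ge0// powR_ge0.
by apply: ereal_sup_ubound; exists (1, 0) => //=; exact: oner_neq0.
Qed.

Lemma holder1_norm_ge0 b f : (0 <= holder1_norm b f)%E.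
Proof. by rewrite adde_ge0 ?sup_norm_ge0 ?holder_norm_ge0. Qed.

Lemma sup_norm_le f S : (forall x, `|f x| <= S) -> (sup_norm f <= S%:E)%E.
Proof. by move=> fS; apply: ge_ereal_sup => _ [x _ <-]; rewrite lee_fin. Qed.

Lemma norm_even_le f S : (forall x, `|f (- x)| = `|f x|) ->
  f x @[x --> 0^'-] --> f 0 -> (forall x, x < 0 -> `|f x| <= S) ->
  forall x, `|f x| <= S.
Proof.
move=> fN f0 fS x; have [x0|x0|->] := ltgtP x 0; first exact: fS.
  by rewrite -fN fS// oppr_lt0.
have m1 : (- 1 : R) < 0 by lra.
apply: (cvg_left_le m1 (cvg_norm f0)) => y _; exact: fS.
Qed.

Lemma cube_dist_le_closed f A (n : nat) : f x @[x --> 0^'-] --> f 0 ->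
  (forall x y, x < 0 -> y < 0 -> `|f x - f y| ^+ 3 <= A * `|x - y| ^+ n) ->
  forall x y, x <= 0 -> y <= 0 -> `|f x - f y| ^+ 3 <= A * `|x - y| ^+ n.
Proof.
move=> f0 fA.
have m1 : (- 1 : R) < 0 by lra.
have half y : y < 0 -> `|f 0 - f y| ^+ 3 <= A * `|0 - y| ^+ n.
  move=> y0; rewrite -subr_ge0.
  have l : A * `|x - y| ^+ n - `|f x - f y| ^+ 3 @[x --> 0^'-] -->
      A * `|0 - y| ^+ n - `|f 0 - f y| ^+ 3.
    apply: cvgB.
      apply: cvgMr; apply: (@continuous_cvg _ _ _ _ _ _ (fun z : R => z ^+ n)).
        exact: exprn_continuous.
      apply: cvg_norm; apply: cvg_at_left_filter.
      by eapply (@is_derive_continuous _ (fun x => x - y)); isder.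
    apply: (@continuous_cvg _ _ _ _ _ _ (fun z : R => z ^+ 3)).
      exact: exprn_continuous.
    by apply: cvg_norm; apply: cvgB => //; exact: cvg_cst.
  apply: (cvg_left_ge m1 l) => x _ x0; rewrite subr_ge0; exact: fA.
move=> x y; rewrite le_eqVlt => /predU1P[->|x0]; rewrite le_eqVlt => /predU1P[->|y0].
- have A0 : 0 <= A.
    have := half _ m1; move=> /(le_trans (exprn_ge0 _ (normr_ge0 _))).
    by rewrite pmulr_lge0// exprn_gt0// normr_gt0; lra.
  by rewrite !subrr normr0 expr0n/= mulr_ge0// exprn_ge0.
- exact: half.
- by rewrite distrC (distrC x); exact: half.
- exact: fA.
Qed.

(** Both points are reflected to - |x| and - |y|, which does not increase their distance. *)
Lemma even_cube_dist_le f A (n : nat) : 0 <= A -> f \o -%R = f ->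
  f x @[x --> 0^'-] --> f 0 ->
  (forall x y, x < 0 -> y < 0 -> `|f x - f y| ^+ 3 <= A * `|x - y| ^+ n) ->
  forall x y, `|f x - f y| ^+ 3 <= A * `|x - y| ^+ n.
Proof.
move=> A0 fN f0 fA x y.
have fabs z : f z = f (- `|z|).
  have [z0|z0] := leP 0 z; last by rewrite ltr0_norm// opprK.
  by rewrite ger0_norm// -[in LHS]fN.
rewrite fabs (fabs y).
apply: le_trans (cube_dist_le_closed f0 fA _ _) _; rewrite ?oppr_le0//.
rewrite ler_wpM2l// lerXn2r ?nnegrE//.
by rewrite opprK addrC [leRHS]distrC ler_dist_dist.
Qed.

(** Points of opposite signs are joined through 0, where f vanishes; then |x - y| = |x| + |y|, and
    the factor 4 comes from [cube_add_le]. *)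
Lemma odd_cube_dist_le f A : 0 <= A -> (forall x, f (- x) = - f x) ->
  f x @[x --> 0^'-] --> f 0 ->
  (forall x y, x < 0 -> y < 0 -> `|f x - f y| ^+ 3 <= A * `|x - y|) ->
  forall x y, `|f x - f y| ^+ 3 <= 4 * A * `|x - y|.
Proof.
move=> A0 fN f0 fA.
have f00 : f 0 = 0 by have := fN 0; rewrite oppr0; lra.
have neg := @cube_dist_le_closed f A 1 f0 fA.
have A4 x y : `|f x - f y| ^+ 3 <= A * `|x - y| -> `|f x - f y| ^+ 3 <= 4 * A * `|x - y|.
  by move=> h; have : 0 <= A * `|x - y| by [rewrite mulr_ge0]; lra.
have mix x y : x <= 0 -> 0 <= y -> `|f x - f y| ^+ 3 <= 4 * A * `|x - y|.
  move=> x0 y0; have hx := neg x 0 x0 (lexx 0).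
  have hy := neg (- y) 0 ltac:(lra) (lexx 0).
  rewrite fN f00 !subr0 !normrN in hx hy.
  apply: le_trans (_ : (`|f x| + `|f y|) ^+ 3 <= _).
    by rewrite ler_pXn2r ?nnegrE ?addr_ge0// ler_normB.
  apply: le_trans (cube_add_le _ _) _ => //.
  have -> : `|x - y| = `|x| + `|y|.
    by rewrite (ler0_norm x0) (ger0_norm y0) distrC ger0_norm; lra.
  by move: hx hy; rewrite !expr1; lra.
move=> x y; have [x0|x0] := leP x 0; have [y0|y0] := leP y 0.
- by apply: A4; exact: neg.
- by apply: mix => //; exact: ltW.
- by rewrite distrC (distrC x); apply: mix => //; exact: ltW.
- have := neg (- x) (- y) ltac:(lra) ltac:(lra); rewrite !fN -!opprD !normrN => h.
  by apply: A4; exact: h.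
Qed.

End HolderNorms.

(** * Hoelder bounds and convergence for the family of waves *)

Section WaveNorms.
Variable R : realType.
Implicit Types (a b k c e x y : R) (rho v phi : R -> R).

Section OneWave.
Variables (k c : R) (rho v phi : R -> R).
Hypotheses (k0 : 0 <= k) (ck : Num.sqrt k < c).
Hypothesis W : peaked_solitary_wave k c rho v phi.
Let H : half_wave k c (fun x => c - v x) phi (phi^`()).
Proof. exact: (peaked_half_wave k0 ck W). Qed.
Let r0 : 0 <= Num.sqrt k. Proof. exact: sqrtr_ge0. Qed.
Let c0 : 0 < c. Proof. exact: (le_lt_trans (sqrtr_ge0 k) ck). Qed.

Lemma velocity_cvg_left0 : v x @[x --> 0^'-] --> v 0.
Proof. exact: (cvg_at_left_filter (psw_v_continuous0 W)). Qed.

Lemma potential_derivable x : derivable phi x 1.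
Proof.
have [->|x0] := eqVneq x 0; first exact: (psw_phi_derivable0 W).
by have [] := psw_derivable W x0.
Qed.

Lemma dpotential_odd x : phi^`() (- x) = - phi^`() x.
Proof.
rewrite (even_derive1N (x := x) (potential_compN W)) ?opprK//.
exact: potential_derivable.
Qed.

Lemma dpotential_cvg_left0 : phi^`() x @[x --> 0^'-] --> phi^`() 0.
Proof. exact: (cvg_at_left_filter (psw_dphi_continuous0 W)). Qed.

Lemma velocity_holder x y : `|v x - v y| ^+ 3 <= 9 / 2 * c * `|x - y| ^+ 2.
Proof.
apply: (even_cube_dist_le _ (velocity_compN W) velocity_cvg_left0).
  by have := c0; lra.
move=> {}x {}y x0 y0; have -> : v x - v y = - ((c - v x) - (c - v y)) by ring.
by rewrite normrN; exact: (hw_u_holder H x0 y0).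
Qed.

Lemma dpotential_holder x y : `|phi^`() x - phi^`() y| ^+ 3 <=
  4 * (24 * c ^+ 2 * (c ^+ 2 + 2)) * `|x - y| ^+ 1.
Proof.
rewrite expr1; apply: (odd_cube_dist_le _ dpotential_odd dpotential_cvg_left0).
  by have := sqr_ge0 c => ?; rewrite mulr_ge0//; lra.
move=> {}x {}y x0 y0; apply: le_trans (hw_psi_holder H x0 y0) _.
have c2 := sqr_ge0 c; rewrite ler_wpM2r// ler_wpM2l//; first by lra.
by have := r0; have := ck; nra.
Qed.

Lemma velocity_norm_le x : `|v x| <= c.
Proof.
move: x; apply: norm_even_le velocity_cvg_left0 _ => [x|x x0].
  by rewrite -[in RHS](velocity_compN W).
have := hw_u_lt H x0; have := hw_u_gt0 H x0.
by rewrite ler_norml => ? ?; apply/andP; split; lra.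
Qed.

Lemma potential_cvg_left0 : phi x @[x --> 0^'-] --> phi 0.
Proof. exact: (hw_phi_left0 H). Qed.

Lemma potential_norm_le x : `|phi x| <= c ^+ 2.
Proof.
move: x; apply: norm_even_le potential_cvg_left0 _ => [x|x x0].
  by rewrite -[in RHS](potential_compN W).
have := hw_phi_gt0 H x0; have /andP[_] := hw_phi_bounds H x0.
have := sqr_ge0 (c - v x); have := sqr_ge0 c.
by rewrite ler_norml => ? ? ? ?; apply/andP; split; lra.
Qed.

Lemma dpotential_norm_le x : `|phi^`() x| <= 2 * c.
Proof.
move: x; apply: norm_even_le dpotential_cvg_left0 _ => [x|x x0].
  by rewrite dpotential_odd normrN.
rewrite -(ler_pXn2r (n := 2)) ?nnegrE ?mulr_ge0 ?(ltW c0)//.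
rewrite real_normK ?num_real//; apply: le_trans (hw_psi_sqr_le_u H x0) _.
have := hw_u_lt H x0; have := hw_u_gt0 H x0; have := c0; nra.
Qed.

Lemma velocity_holder_space b : 0 < b < 2 / 3 -> holder b v.
Proof.
move=> /andP[b0 b23]; rewrite /holder.
apply: le_lt_trans (@holder_norm_le _ v 2 b (9 / 2 * c) c _ b0 _ _
  velocity_norm_le velocity_holder) (ltry _) => //; first lra.
by have := c0; lra.
Qed.

Lemma potential_holder1_space a : 0 < a < 1 / 3 -> holder1 a phi.
Proof.
move=> /andP[a0 a13]; split; first exact: potential_derivable.
rewrite /holder1_norm lte_add_pinfty//.
  exact: (le_lt_trans (sup_norm_le potential_norm_le) (ltry _)).
apply: le_lt_trans (@holder_norm_le _ _ 1 a _ (2 * c) _ a0 _ _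
  dpotential_norm_le dpotential_holder) (ltry _) => //; first lra.
by have := sqr_ge0 c => ?; rewrite mulr_ge0// mulr_ge0//; lra.
Qed.

End OneWave.

Section Family.
Variables (c : R -> R) (rho v phi : R -> R -> R).
Hypothesis hc : forall k, 0 <= k -> peaked_speed k (c k).
Hypothesis hw : forall k, 0 <= k ->
  peaked_solitary_wave k (c k) (rho k) (v k) (phi k).

Let ck k : 0 <= k -> Num.sqrt k < c k.
Proof. by move=> k0; apply: peaked_speed_gt => //; exact: hc. Qed.

Lemma family_half_wave k : 0 <= k ->
  half_wave k (c k) (fun x => c k - v k x) (phi k) ((phi k)^`()).
Proof. by move=> k0; exact: (peaked_half_wave k0 (ck k0) (hw k0)). Qed.

Let H := family_half_wave.
Let H0 := H (lexx 0).

Lemma near_sqrt_le e : 0 < e -> \forall k \near 0^'+, 0 <= k /\ Num.sqrt k <= e.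
Proof.
move=> e0; near=> k.
have k0 : 0 < k by near: k; exact: nbhs_right_gt.
split; first exact: ltW.
rewrite -(ler_pXn2r (n := 2)) ?nnegrE ?sqrtr_ge0 ?(ltW e0)// sqr_sqrtr ?(ltW k0)//.
near: k; apply: nbhs_right_le; exact: exprn_gt0.
Unshelve. all: by end_near. Qed.

Lemma near_speed e : 0 < e -> \forall k \near 0^'+,
  0 <= k /\ Num.sqrt k + `|c k - c 0| <= e.
Proof.
move=> e0; have e20 : 0 < e / 2 by rewrite divr_gt0.
have [d d0 hd] := hw_speed_cvg H0 e20.
near=> k.
have [k0 kd] : 0 <= k /\ Num.sqrt k <= Num.min d (e / 2).
  by near: k; apply: near_sqrt_le; rewrite lt_min d0.
move: kd; rewrite le_min => /andP[kd ke]; split => //.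
by have := hd _ _ _ _ _ (H k0) kd; lra.
Unshelve. all: by end_near. Qed.

Lemma near_half_wave e : 0 < e -> \forall k \near 0^'+,
  [/\ 0 <= k, Num.sqrt k + `|c k - c 0| <= e &
      forall x, x < 0 -> `|(c k - v k x) - (c 0 - v 0 x)| <= e].
Proof.
move=> e0; have [d d0 hd] := hw_u_close H0 e0.
near=> k.
have [k0 kd] : 0 <= k /\ Num.sqrt k + `|c k - c 0| <= Num.min d e.
  by near: k; apply: near_speed; rewrite lt_min d0.
move: kd; rewrite le_min => /andP[kd ke]; split => // x x0.
exact: (hd _ _ _ _ _ (H k0) kd x x0).
Unshelve. all: by end_near. Qed.

Lemma near_velocity e : 0 < e -> \forall k \near 0^'+,
  forall x, `|v k x - v 0 x| <= e.
Proof.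
move=> e0; near=> k.
have [k0 ce ue] : [/\ 0 <= k, Num.sqrt k + `|c k - c 0| <= e / 2 &
      forall x, x < 0 -> `|(c k - v k x) - (c 0 - v 0 x)| <= e / 2].
  by near: k; apply: near_half_wave; rewrite divr_gt0.
apply: norm_even_le => [x| |x x0].
- by rewrite -[in RHS](velocity_compN (hw k0)) -[in RHS](velocity_compN (hw (lexx 0))).
- by apply: cvgB; [exact: (velocity_cvg_left0 (hw k0))|
    exact: (velocity_cvg_left0 (hw (lexx 0)))].
have := ue x x0; have := sqrtr_ge0 k; move: ce; have := ler_norm (c k - c 0).
have := ler_norm (- (c k - c 0)); rewrite normrN !ler_norml => ? ? ? ? /andP[? ?].
by apply/andP; split; lra.
Unshelve. all: by end_near. Qed.

Let B : R := c 0 + 1.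

Lemma near_potential e : 0 < e -> \forall k \near 0^'+,
  (forall x, `|phi k x - phi 0 x| <= e) /\
  (forall x, `|(phi k)^`() x - (phi 0)^`() x| <= e).
Proof.
move=> e0; have c01 := hw_c_gt1 H0.
have B0 : 0 < B by rewrite /B; lra.
pose K : R := 6 * B * (3 + expR (B ^+ 2 / 2)).
have K0 : 0 < K by rewrite !mulr_gt0// addr_gt0 ?expR_gt0.
(* [hw_phi_close] and [hw_psi_sqr_close] add a parameter distance and a distance of velocities, each
   at most d; hence d + d below. *)
pose d : R := Num.min (1 / 2) (Num.min (e / (3 * B) / 2) (e ^+ 2 / K / 2)).
have d0 : 0 < d by rewrite !lt_min !divr_gt0 ?exprn_gt0 ?mulr_gt0.
have d1 : d <= 1 / 2 by rewrite /d !ge_min lexx.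
have de : 3 * B * (d + d) <= e.
  have : d <= e / (3 * B) / 2 by rewrite /d !ge_min lexx !orbT.
  move=> h; rewrite mulrC -ler_pdivlMr ?mulr_gt0//; lra.
have dK : K * (d + d) <= e ^+ 2.
  have : d <= e ^+ 2 / K / 2 by rewrite /d !ge_min lexx !orbT.
  move=> h; rewrite mulrC -ler_pdivlMr//; lra.
clearbody d; near=> k.
have [k0 ce ue] : [/\ 0 <= k, Num.sqrt k + `|c k - c 0| <= d &
      forall x, x < 0 -> `|(c k - v k x) - (c 0 - v 0 x)| <= d].
  by near: k; apply: near_half_wave.
have r0 := sqrtr_ge0 k; have cc : `|c k - c 0| <= 1 by lra.
split; apply: norm_even_le => [x| |x x0].
- by rewrite -[in RHS](potential_compN (hw k0)) -[in RHS](potential_compN (hw (lexx 0))).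
- by apply: cvgB; [exact: (hw_phi_left0 (H k0))|exact: (hw_phi_left0 H0)].
- apply: le_trans (hw_phi_close (H k0) H0 cc x0 x0) _.
  apply: le_trans de; rewrite ler_pM2l ?mulr_gt0//.
  by rewrite lerD// ue.
- by rewrite (dpotential_odd (hw k0)) (dpotential_odd (hw (lexx 0))) -opprD normrN.
- by apply: cvgB; [exact: (dpotential_cvg_left0 (hw k0))|
    exact: (dpotential_cvg_left0 (hw (lexx 0)))].
(* Both slopes are positive to the left of 0, so |p - q| <= p + q and (p - q)^2 <= |p^2 - q^2|. *)
have p0 := hw_psi_gt0 (H k0) x0; have q0 := hw_psi_gt0 H0 x0.
rewrite -(ler_pXn2r (n := 2)) ?nnegrE ?(ltW e0)//.
apply: le_trans (_ : `|(phi k)^`() x ^+ 2 - (phi 0)^`() x ^+ 2| <= _).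
  rewrite subr_sqr normrM expr2 ler_wpM2l//.
  rewrite (ger0_norm (addr_ge0 (ltW p0) (ltW q0))) ler_norml.
  by apply/andP; split; lra.
apply: le_trans (hw_psi_sqr_close (H k0) H0 cc x0 x0) _.
apply: le_trans dK; rewrite ler_pM2l// lerD// ue//.
Unshelve. all: by end_near. Qed.

Lemma velocity_cvg_holder b : 0 < b < 2 / 3 -> cvg0_holder b v.
Proof.
move=> hb; split => [k k0|].
  exact: (velocity_holder_space k0 (ck k0) (hw k0) hb).
have /andP[b0 b23] := hb; have c01 := hw_c_gt1 H0.
apply: cvge0_near_le => [k|e e0]; first exact: holder_norm_ge0.
pose A : R := 4 * (9 / 2 * B + 9 / 2 * B).
have A0 : 0 <= A by rewrite /A /B; lra.
have b3 : 3 * b < 2%:R by lra.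
have [S S0 hS] := holder_bound_small A (erefl : (0 < 2)%N) b0 b3 e0.
near=> k.
have [k0 ce] : 0 <= k /\ Num.sqrt k + `|c k - c 0| <= 1.
  by near: k; exact: near_speed.
have vS : forall x, `|v k x - v 0 x| <= S by near: k; exact: near_velocity.
apply: le_trans (holder_norm_le (erefl : (0 < 2)%N) b0 b3 A0 vS _) _; last first.
  by rewrite lee_fin.
move=> x y.
apply: le_trans (cube_dist_diff_le (velocity_holder k0 (ck k0) (hw k0) x y)
  (velocity_holder (lexx 0) (ck (lexx 0)) (hw (lexx 0)) x y)) _.
rewrite ler_wpM2r ?exprn_ge0// /A /B.
by have := ler_norm (c k - c 0); have := sqrtr_ge0 k; lra.
Unshelve. all: by end_near. Qed.

Lemma potential_cvg_holder1 a : 0 < a < 1 / 3 -> cvg0_holder1 a phi.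
Proof.
move=> ha; split => [k k0|].
  exact: (potential_holder1_space k0 (ck k0) (hw k0) ha).
have /andP[a0 a13] := ha; have c01 := hw_c_gt1 H0.
apply: cvge0_near_le => [k|e e0]; first exact: holder1_norm_ge0.
pose L (x : R) : R := 4 * (24 * x ^+ 2 * (x ^+ 2 + 2)).
pose A : R := 4 * (L B + L B).
have L0 x : 0 <= L x.
  by have := sqr_ge0 x => ?; rewrite mulr_ge0// mulr_ge0//; lra.
have A0 : 0 <= A by rewrite mulr_ge0// addr_ge0.
have LB x : 0 <= x -> x <= B -> L x <= L B.
  move=> x0 xB; rewrite ler_pM2l//.
  have x2 : x ^+ 2 <= B ^+ 2 by rewrite ler_pXn2r ?nnegrE// (le_trans x0).
  by rewrite ler_pM ?mulr_ge0 ?addr_ge0 ?sqr_ge0//; lra.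
have a3 : 3 * a < 1%:R by lra.
have e20 : 0 < e / 2 by rewrite divr_gt0.
have [S S0 hS] := holder_bound_small A (erefl : (0 < 1)%N) a0 a3 e20.
near=> k.
have [k0 ce] : 0 <= k /\ Num.sqrt k + `|c k - c 0| <= 1.
  by near: k; exact: near_speed.
have [pS dS] : (forall x, `|phi k x - phi 0 x| <= Num.min S (e / 2)) /\
  (forall x, `|(phi k)^`() x - (phi 0)^`() x| <= Num.min S (e / 2)).
  by near: k; apply: near_potential; rewrite lt_min S0.
rewrite [e]splitr EFinD; apply: leeD.
  by apply: sup_norm_le => x; apply: le_trans (pS x) _; rewrite ge_min lexx orbT.
have -> : (phi k \- phi 0)^`() = (phi k)^`() \- (phi 0)^`().
  apply/funext => x; apply: derive1_is_derive; apply: is_derive_add.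
    exact: (is_derive_derive1 (@potential_derivable _ _ _ _ _ (hw k0) x)).
  apply: is_derive_opp.
  exact: is_derive_derive1 (@potential_derivable _ _ _ _ _ (hw (lexx 0)) x).
have {}dS x : `|((phi k)^`() \- (phi 0)^`()) x| <= S.
  by apply: le_trans (dS x) _; rewrite ge_min lexx.
apply: le_trans (holder_norm_le (erefl : (0 < 1)%N) a0 a3 A0 dS _) _; last first.
  by rewrite lee_fin.
move=> x y.
apply: le_trans (cube_dist_diff_le (dpotential_holder k0 (ck k0) (hw k0) x y)
  (dpotential_holder (lexx 0) (ck (lexx 0)) (hw (lexx 0)) x y)) _.
rewrite ler_wpM2r ?exprn_ge0// ler_pM2l//.
have r0 := sqrtr_ge0 k; have rc := ck k0.
rewrite lerD//; apply: LB; rewrite /B; last 2 first.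
- lra.
- lra.
- lra.
- by have := ler_norm (c k - c 0); lra.
Unshelve. all: by end_near. Qed.

End Family.
End WaveNorms.

(** * Convergence in L^p *)

Section DensityBound.
Variable R : realType.
Implicit Types (a b s x y : R).

Section OneWave.
Variables (k c : R) (u phi psi : R -> R).
Hypothesis H : half_wave k c u phi psi.

Lemma hw_psi_sqr_Ny : psi x ^+ 2 @[x --> -oo] --> 0.
Proof.
have c0 := hw_c_gt0 H; set r := Num.sqrt k.
have l : 2 * (c * (u x - r) ^+ 2 / u x - (1 + (c - r) ^+ 2) + expR (phi x))
    @[x --> -oo] --> 2 * (c * (c - r) ^+ 2 / c - (1 + (c - r) ^+ 2) + expR 0).
  apply: cvgMr; apply: cvgD.
    apply: cvgB; last exact: cvg_cst.
    apply: cvgM; last by apply: cvgV; [rewrite gt_eqF|exact: hw_u_Ny H].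
    apply: cvgMr; apply: (@continuous_cvg _ _ _ _ _ _ (fun z : R => z ^+ 2)).
      exact: exprn_continuous.
    by apply: cvgB; [exact: hw_u_Ny H|exact: cvg_cst].
  apply: (@continuous_cvg _ _ _ _ _ _ (@expR R)); first exact: continuous_expR.
  exact: hw_phi_Ny H.
rewrite mulrAC divff ?gt_eqF// expR0 in l.
rewrite (_ : 0 = 2 * (1 * (c - r) ^+ 2 - (1 + (c - r) ^+ 2) + 1)); last by ring.
apply: cvg_trans l; apply: near_eq_cvg; near=> x.
have x0 : x < 0 by near: x; exact: near_Ny_lt.
have := hw_energy H x0; rewrite -/r; lra.
Unshelve. all: by end_near. Qed.

Lemma hw_u_cube_ge B x : c <= B -> x < 0 -> 2 * (1 + B ^+ 2) * u x <= 1 ->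
  9 / 16 * x ^+ 2 <= u x ^+ 3.
Proof.
move=> cB x0 uB; have c1 := hw_c_gt1 H; have ux := hw_u_gt0 H x0.
have rc := hw_c_gt H; have r0 := sqrtr_ge0 k.
have uE : 2 * (1 + (c - Num.sqrt k) ^+ 2) * u x <= c.
  apply: le_trans (le_trans uB (ltW c1)); rewrite ler_wpM2r ?(ltW ux)//; nra.
have := hw_u_lower H x0 uE.
have sc : 1 <= Num.sqrt c by rewrite -[leLHS]sqrtr1 ler_wsqrtr// ltW.
have : - x <= Num.sqrt c * - x by rewrite ler_peMl// oppr_ge0 ltW.
move=> h1 h2; have {h1 h2} : 3 / 4 * - x <= u x * Num.sqrt (u x) by lra.
rewrite -(ler_pXn2r (n := 2)) ?nnegrE; last 3 first.
- by [].
- by rewrite mulr_ge0// oppr_ge0 ltW.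
- by rewrite mulr_ge0 ?sqrtr_ge0// ltW.
rewrite !exprMn sqr_sqrtr ?(ltW ux)// sqrrN -exprSr.
by apply: le_trans; rewrite le_eqVlt; apply/orP; left; apply/eqP; field.
Qed.

Section Tail.
Variables (tau X : R).
Hypotheses (tau1 : 1 < tau) (X0 : X < 0) (uX : tau <= u X ^+ 2 - k).
(** For x <= X, phi >= (u^2 - k) (c - u) / u >= tau (rho - 1). Hence exp phi - rho >= phi - phi /
    tau, which is the source of this constant. *)
Let a : R := 1 - tau^-1.

Let a0 : 0 < a.
Proof. by rewrite subr_gt0 invf_lt1//; exact: lt_trans ltr01 tau1. Qed.

Let a1 : a < 1.
Proof. by rewrite /a gtrBl invr_gt0; exact: lt_trans ltr01 tau1. Qed.

Let density_le x : x <= X -> 0 <= c / u x - 1 <= (1 - a) * phi x.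
Proof.
move=> xX; have x0 : x < 0 by exact: le_lt_trans X0.
have ux := hw_u_gt0 H x0; have uc := hw_u_lt H x0; have uX0 := hw_u_gt0 H X0.
have uxX : u X <= u x.
  move: xX; rewrite le_eqVlt => /predU1P[->//|xX].
  exact/ltW/(hw_u_decreasing H).
have -> : c / u x - 1 = (c - u x) / u x by field; rewrite gt_eqF.
have cu0 : 0 <= (c - u x) / u x by rewrite divr_ge0 ?subr_ge0 ?(ltW uc) ?(ltW ux).
rewrite cu0/=.
have t0 : 0 < tau by exact: lt_trans ltr01 tau1.
have -> : 1 - a = tau^-1 by rewrite /a; ring.
rewrite -ler_pdivrMl ?invr_gt0// invrK.
rewrite (hw_phiE H)//; have /andP[_] := hw_ln_bounds H x0.
have k0 := hw_k_ge0 H.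
suff : tau * ((c - u x) / u x) <= (c ^+ 2 - u x ^+ 2) / 2 - k * (c - u x) / u x by lra.
have -> : (c ^+ 2 - u x ^+ 2) / 2 - k * (c - u x) / u x =
    ((c + u x) / 2 * u x - k) * ((c - u x) / u x) by field; rewrite gt_eqF.
rewrite ler_wpM2r//; have := uX; have := uxX; have := uX0; have := uc; nra.
Qed.

Let dpsi_ge x : x <= X -> a * phi x <= expR (phi x) - c / u x.
Proof.
by move=> /density_le/andP[_]; have := expR_ge1Dx (phi x); lra.
Qed.

(** Multiplying phi'' >= a phi by 2 psi shows that psi^2 - a phi^2 is nondecreasing, with limit 0 at
    -oo. As a < 1, a phi <= sqrt a phi, which avoids a square root. *)
Let psi_ge x : x <= X -> a * phi x <= psi x.
Proof.
move=> xX; have x0 : x < 0 by exact: le_lt_trans X0.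
have phi0 := hw_phi_gt0 H x0; have psi0 := hw_psi_gt0 H x0.
rewrite -(ler_pXn2r (n := 2)) ?nnegrE ?mulr_ge0 ?(ltW a0) ?(ltW phi0) ?(ltW psi0)//.
pose f y := psi y ^+ 2 - a * phi y ^+ 2.
pose df y := 2 * psi y * ((expR (phi y) - c / u y) - a * phi y).
have dfP y : y < 0 -> is_derive y 1 f (df y).
  move=> y0; have ? := hw_dphi H y0; have ? := hw_dpsi H y0.
  by eapply is_derive_subst; [rewrite /f; isder|rewrite /df /=; ring].
have fNy : f y @[y --> -oo] --> 0 - a * (0 * 0).
  apply: cvgB; first exact: hw_psi_sqr_Ny.
  by apply: cvgMr; apply: cvgM; exact: hw_phi_Ny H.
rewrite !mulr0 subr0 in fNy.
have : 0 <= f x.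
  apply: (cvg_Ny_le (x := x) fNy) => y yx.
  apply: (derive_ge0_nondecreasing dfP _ (ltW yx) x0) => z _ zx.
  have z0 : z < 0 by exact: lt_trans zx x0.
  rewrite mulr_ge0 ?mulr_ge0 ?(ltW (hw_psi_gt0 H z0))// subr_ge0.
  by apply: dpsi_ge; exact: le_trans (ltW zx) xX.
rewrite /f exprMn.
have : a ^+ 2 * phi x ^+ 2 <= a * phi x ^+ 2.
  by rewrite ler_wpM2r ?sqr_ge0// expr2 ler_piMr ?(ltW a0) ?(ltW a1).
lra.
Qed.

(** The decay is exponential, but a quadratic weight suffices: its cube dominates x^2 (1 + |x|)^4 up
    to a constant. *)
Let phi_decay x : x <= X -> phi x * (1 + a / 2 * (X - x)) ^+ 2 <= phi X.
Proof.
move=> xX; pose f y := phi y * (1 + a / 2 * (X - y)) ^+ 2.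
pose df y := (1 + a / 2 * (X - y)) *
  (psi y * (1 + a / 2 * (X - y)) - a * phi y).
have dfP y : y < 0 -> is_derive y 1 f (df y).
  move=> y0; have ? := hw_dphi H y0.
  by eapply is_derive_subst; [rewrite /f; isder|rewrite /df /=; field].
have -> : phi X = f X by rewrite /f subrr mulr0 addr0 expr1n mulr1.
apply: (derive_ge0_nondecreasing dfP _ xX X0) => z _ zX.
have z0 : z < 0 by exact: lt_trans zX X0.
have s0 : 0 <= a / 2 * (X - z).
  by rewrite mulr_ge0 ?divr_ge0 ?(ltW a0)// subr_ge0 ltW.
apply: mulr_ge0; first by rewrite addr_ge0.
rewrite subr_ge0; apply: le_trans (psi_ge (ltW zX)) _.
by rewrite ler_peMr ?lerDl// ltW// (hw_psi_gt0 H).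
Qed.

(** The first summand serves x <= X. The second serves X < x < 0: 2 B^3 where u is small and
    [hw_u_cube_ge] applies, the other term where c / u <= 2 B (1 + B^2). Only [tau], [X] and [B]
    enter, whence uniformity in k. *)
Definition density_const B : R :=
  ((1 - X + 2 / a) ^+ 2 * B ^+ 2) ^+ 3
  + (2 * B ^+ 3 + (2 * B * (1 + B ^+ 2)) ^+ 3 * X ^+ 2) * (1 - X) ^+ 4.

Lemma hw_density_bound B x : c <= B -> x < 0 ->
  0 <= c / u x - 1 /\
  (c / u x - 1) ^+ 3 * x ^+ 2 * (1 - x) ^+ 4 <= density_const B.
Proof.
move=> cB x0; have c1 := hw_c_gt1 H; have ux := hw_u_gt0 H x0.
have rho1 : 0 <= c / u x - 1.
  by rewrite subr_ge0 ler_pdivlMr// mul1r ltW// (hw_u_lt H).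
split => //.
have B0 : 0 < B by lra.
have Xp : 0 <= 1 - X by have := X0; lra.
have l0 : 0 <= 1 - X + 2 / a by rewrite addr_ge0 ?divr_ge0 ?(ltW a0).
have p1 : 0 <= ((1 - X + 2 / a) ^+ 2 * B ^+ 2) ^+ 3.
  by rewrite exprn_ge0// mulr_ge0 ?sqr_ge0.
have p2 : 0 <= (2 * B ^+ 3 + (2 * B * (1 + B ^+ 2)) ^+ 3 * X ^+ 2) * (1 - X) ^+ 4.
  have B2 : 0 <= 2 * B * (1 + B ^+ 2).
    by rewrite mulr_ge0 ?addr_ge0 ?sqr_ge0// mulr_ge0// ltW.
  rewrite mulr_ge0 ?exprn_ge0// addr_ge0//; first by rewrite mulr_ge0// exprn_ge0// ltW.
  by rewrite mulr_ge0 ?sqr_ge0// exprn_ge0.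
have [xX|Xx] := leP x X.
  apply: le_trans (_ : ((1 - X + 2 / a) ^+ 2 * B ^+ 2) ^+ 3 <= _); last by rewrite lerDl.
  have phi0 := hw_phi_gt0 H x0.
  have h1 : c / u x - 1 <= phi x.
    have /andP[_ h] := density_le xX; apply: le_trans h _.
    by rewrite ler_piMl ?(ltW phi0)// gerBl ltW.
  have s0 : 0 <= a / 2 * (X - x).
    by rewrite mulr_ge0 ?divr_ge0 ?(ltW a0)// subr_ge0.
  (* 2 / a times a / 2 (X - x) is X - x, so this constant trades the weight 1 - x for that of
     [phi_decay]. *)
  have h2 : 1 - x <= (1 - X + 2 / a) * (1 + a / 2 * (X - x)).
    have -> : (1 - X + 2 / a) * (1 + a / 2 * (X - x)) =
       1 - x + (2 / a + (1 - X) * (a / 2 * (X - x))) by field; rewrite gt_eqF.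
    by rewrite lerDl addr_ge0 ?divr_ge0 ?(ltW a0)// mulr_ge0.
  have h3 : phi x * (1 - x) ^+ 2 <= (1 - X + 2 / a) ^+ 2 * B ^+ 2.
    apply: le_trans (_ : phi x * ((1 - X + 2 / a) * (1 + a / 2 * (X - x))) ^+ 2 <= _).
      have y1 : 0 <= (1 - X + 2 / a) * (1 + a / 2 * (X - x)) by rewrite mulr_ge0// addr_ge0.
      by rewrite ler_wpM2l ?(ltW phi0)// ler_pXn2r ?nnegrE//; lra.
    rewrite exprMn mulrCA ler_wpM2l ?sqr_ge0//; apply: le_trans (phi_decay xX) _.
    have /andP[_] := hw_phi_bounds H X0; have := sqr_ge0 (u X).
    have : c ^+ 2 <= B ^+ 2 by rewrite ler_pXn2r ?nnegrE//; lra.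
    have := sqr_ge0 B; lra.
  apply: le_trans (_ : (phi x * (1 - x) ^+ 2) ^+ 3 <= _); last first.
    rewrite ler_pXn2r ?nnegrE//; first by rewrite mulr_ge0 ?sqr_ge0// ltW.
    by rewrite mulr_ge0 ?sqr_ge0.
  have -> : (phi x * (1 - x) ^+ 2) ^+ 3 = phi x ^+ 3 * (1 - x) ^+ 2 * (1 - x) ^+ 4 by ring.
  rewrite ler_wpM2r ?exprn_ge0//; first lra.
  rewrite ler_pM ?sqr_ge0 ?exprn_ge0//.
    by rewrite ler_pXn2r ?nnegrE// ltW.
  have -> : (1 - x) ^+ 2 = x ^+ 2 + (1 - 2 * x) by ring.
  by rewrite lerDl; lra.
apply: le_trans (_ : (2 * B ^+ 3 + (2 * B * (1 + B ^+ 2)) ^+ 3 * X ^+ 2) * (1 - X) ^+ 4 <= _);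
  last by rewrite lerDr.
have cu : 0 <= c / u x by rewrite divr_ge0 ?ltW//; lra.
have x2 : x ^+ 2 <= X ^+ 2 by move: x0 Xx => /ltW + /ltW; nra.
have B2 : 0 < 2 * (1 + B ^+ 2) by rewrite mulr_gt0// ltr_wpDr ?sqr_ge0.
have g1 : 0 <= B ^+ 3 by rewrite exprn_ge0// ltW.
have B3 : 0 <= 2 * B * (1 + B ^+ 2).
  by rewrite mulrAC (mulr_ge0 (ltW B2) (ltW B0)).
have g2 : 0 <= (2 * B * (1 + B ^+ 2)) ^+ 3.
  exact: exprn_ge0.
rewrite ler_pM//.
- by rewrite mulr_ge0 ?sqr_ge0// exprn_ge0.
- by rewrite exprn_ge0//; lra.
- apply: le_trans (_ : (c / u x) ^+ 3 * x ^+ 2 <= _).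
    rewrite ler_wpM2r ?sqr_ge0// ler_pXn2r ?nnegrE//; lra.
  have [us|us] := leP (2 * (1 + B ^+ 2) * u x) 1.
    have := hw_u_cube_ge cB x0 us => h.
    apply: le_trans (_ : 2 * B ^+ 3 <= _); last by rewrite lerDl mulr_ge0 ?sqr_ge0.
    rewrite expr_div_n mulrAC ler_pdivrMr ?exprn_gt0//.
    apply: le_trans (_ : B ^+ 3 * x ^+ 2 <= _).
      have cp : 0 <= c by exact: ltW (lt_trans ltr01 c1).
      by rewrite ler_wpM2r ?sqr_ge0// ler_pXn2r ?nnegrE ?(ltW B0).
    have -> : 2 * B ^+ 3 * u x ^+ 3 = B ^+ 3 * (2 * u x ^+ 3) by ring.
    by rewrite ler_wpM2l//; have := sqr_ge0 x; lra.
  apply: le_trans (_ : (2 * B * (1 + B ^+ 2)) ^+ 3 * X ^+ 2 <= _); last first.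
    by rewrite lerDr mulr_ge0.
  rewrite ler_pM ?sqr_ge0 ?exprn_ge0// ler_pXn2r ?nnegrE//.
  rewrite ler_pdivrMr//; apply: le_trans cB _.
  have -> : 2 * B * (1 + B ^+ 2) * u x = B * (2 * (1 + B ^+ 2) * u x) by ring.
  by rewrite ler_peMr ?(ltW B0)//; exact: ltW.
- have x1 : 0 <= 1 - x by lra.
  by rewrite ler_pXn2r ?nnegrE// lerD2l lerN2 ltW.
Qed.

End Tail.

Lemma hw_tail_exists : exists X tau, [/\ X < 0, 1 < tau & tau <= u X ^+ 2 - k].
Proof.
have c2 := hw_c_sqr_gt H.
have l : u x * u x - k @[x --> -oo] --> c * c - k.
  by apply: cvgB; [apply: cvgM; exact: hw_u_Ny H|exact: cvg_cst].
(* [tau] is the midpoint of 1 and c^2 - k, the limit of u^2 - k at -oo. *)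
near (ninfty_nbhs R) => X; exists X, ((1 + (c ^+ 2 - k)) / 2); split; [|lra|].
  by near: X; exact: near_Ny_lt.
by near: X; apply: (cvgr_ge _ l); lra.
Unshelve. all: by end_near. Qed.

End OneWave.
End DensityBound.

(** * An integrable majorant *)

Section DominatingFunction.
Variable R : realType.
Implicit Types (q t x M : R).
Notation mu := (@lebesgue_measure R).

(* On x > 0 its antiderivative is (1 - q)^-1 x^(1 - q) (1 + x)^(q - 1).  At
   x = 0 the junk value of the negative power is 0. *)
Definition dominating q x : R := `|x| `^ (- q) * (1 + `|x|) `^ (q - 2).

Lemma is_derive_powR_comp (f : R -> R) x a r : 0 < f x -> is_derive x 1 f a ->
  is_derive x 1 (fun y => f y `^ r) (r * f x `^ (r - 1) * a).
Proof.
by move=> fx fa; exact: (is_derive1_comp (is_derive1_powR r fx) fa).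
Qed.

Lemma dominating_ge0 q x : 0 <= dominating q x.
Proof. by rewrite mulr_ge0 ?powR_ge0. Qed.

Lemma measurable_dominating q : measurable_fun setT (dominating q).
Proof.
apply: measurable_funM.
  by apply: (@measurableT_comp _ _ _ _ _ _ (@powR R ^~ (- q))) => //; exact: measurableT_comp.
apply: (@measurableT_comp _ _ _ _ _ _ (@powR R ^~ (q - 2))) => //.
by apply: measurable_funD => //; exact: measurableT_comp.
Qed.

Lemma integral_dominating_itv q a b : q < 1 -> 0 < a -> a < b ->
  (\int[mu]_(x in `[a, b]) (dominating q x)%:E <= ((1 - q)^-1)%:E)%E.
Proof.
move=> q1 a0 ab.
pose g x : R := x `^ (- q) * (1 + x) `^ (q - 2).
pose G x : R := (1 - q)^-1 * (x `^ (1 - q) * (1 + x) `^ (q - 1)).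
have q10 : 1 - q != 0 by rewrite gt_eqF// subr_gt0.
have dG x : 0 < x -> is_derive x 1 G (g x).
  move=> x0; have x1 : 0 < 1 + x by rewrite addr_gt0.
  have h1 := is_derive_powR_comp (1 - q) x0 (is_derive_id x 1).
  have h2 : is_derive x 1 (fun y => 1 + y) 1.
    by eapply is_derive_subst; [isder|rewrite add0r].
  have h3 := is_derive_powR_comp (q - 1) x1 h2.
  eapply is_derive_subst.
    exact: is_derive_mul (is_derive_cst _ _ _) (is_derive_mul h1 h3).
  rewrite /g -[cst _ x]/((1 - q)^-1); cbv beta.
  have -> : 1 - q - 1 = - q by ring.
  have -> : q - 1 - 1 = q - 2 by ring.
  have -> : x `^ (1 - q) = x * x `^ (- q).
    by rewrite powRD ?(gt_eqF x0) ?implybT// powRr1// ltW.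
  have -> : (1 + x) `^ (q - 1) = (1 + x) * (1 + x) `^ (q - 2).
    have -> : q - 1 = 1 + (q - 2) by ring.
    rewrite [LHS]powRD; first by rewrite powRr1// ltW.
    by rewrite (gt_eqF x1) implybT.
  by field.
have dg x : 0 < x -> derivable g x 1.
  move=> x0; have x1 : 0 < 1 + x by rewrite addr_gt0.
  have h1 := is_derive_powR_comp (- q) x0 (is_derive_id x 1).
  have h2 : is_derive x 1 (fun y => 1 + y) 1.
    by eapply is_derive_subst; [isder|rewrite add0r].
  have h3 := is_derive_powR_comp (q - 2) x1 h2.
  by have [] := is_derive_mul h1 h3.
have -> : (\int[mu]_(x in `[a, b]) (dominating q x)%:E =
           \int[mu]_(x in `[a, b]) (g x)%:E)%E.
  apply: eq_integral => x; rewrite inE/= in_itv/= => /andP[ax _].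
  by rewrite /dominating ger0_norm// (le_trans (ltW a0)).
rewrite (@continuous_FTC2 _ g G)//.
- rewrite -EFinB lee_fin.
  (* G x is (1 - q)^-1 (x / (1 + x))^(1 - q), hence bounded independently of the interval. *)
  have G0 x : 0 < x -> 0 <= G x <= (1 - q)^-1.
    move=> x0; have x1 : 0 < 1 + x by rewrite addr_gt0.
    have iq : 0 < (1 - q)^-1 by rewrite invr_gt0 subr_gt0.
    rewrite /G mulr_ge0 ?mulr_ge0 ?powR_ge0 ?(ltW iq)//=.
    rewrite -[leRHS]mulr1 ler_pM2l//.
    have -> : q - 1 = - (1 - q) by ring.
    rewrite powRN ler_pdivrMr ?powR_gt0// mul1r.
    apply: ge0_ler_powR; rewrite ?nnegrE ?subr_ge0 ?ltW//; rewrite ltrDr//.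
  have /andP[+ _] := G0 a a0; have /andP[_ +] := G0 b (lt_trans a0 ab); lra.
- apply: derivable_within_continuous => x; rewrite in_itv/= => /andP[ax _].
  by apply: dg; exact: lt_le_trans ax.
- split => [x||].
  + rewrite in_itv/= => /andP[ax _].
    by have [] := dG x (lt_trans a0 ax).
  + apply: cvg_at_right_filter; exact: is_derive_continuous (dG a a0).
  + apply: cvg_at_left_filter; exact: is_derive_continuous (dG b (lt_trans a0 ab)).
- move=> x; rewrite in_itv/= => /andP[ax _].
  exact: derive1_is_derive (dG x (lt_trans a0 ax)).
Qed.

Lemma integral_dominating_pos q : 0 < q -> q < 1 ->
  (\int[mu]_(x in `[0%R, +oo[) (dominating q x)%:E <= ((1 - q)^-1)%:E)%E.
Proof.
move=> q0 q1.
(* The shift by 2 makes every interval nondegenerate, starting with [1/2, 2]. *)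
pose F (n : nat) : set R := `[(n.+2%:R : R)^-1, n.+2%:R]%classic.
have FU : \bigcup_n F n = `]0, +oo[%classic :> set R.
  apply/seteqP; split => x /=.
    move=> [n _]; rewrite /F /= !in_itv/= andbT => /andP[+ _].
    by apply: lt_le_trans; rewrite invr_gt0.
  rewrite in_itv/= andbT => x0.
  pose m := Num.truncn (x + x^-1); exists m => //; rewrite /F /= in_itv/=.
  have xm : x + x^-1 < m.+1%:R by exact: truncnS_gt.
  have m2 : m.+1%:R <= m.+2%:R :> R by rewrite ler_nat.
  have ix : 0 < x^-1 by rewrite invr_gt0.
  apply/andP; split; last by lra.
  by rewrite -[leRHS]invrK lef_pV2 ?posrE//; lra.
have -> : (\int[mu]_(x in `[0%R, +oo[) (dominating q x)%:E =
           \int[mu]_(x in \bigcup_n F n) (dominating q x)%:E)%E.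
  rewrite FU integral_mkcond [RHS]integral_mkcond; congr (integral _ _ _).
  apply/funext => x; rewrite /patch !mem_setE/= !in_itv/= !andbT le_eqVlt.
  have [<-|//] := eqVneq 0 x; rewrite /= ltxx.
  by rewrite /dominating normr0 powR0 ?mul0r// oppr_eq0 gt_eqF.
have ndF : {homo F : n m / (n <= m)%N >-> (n <= m)%O}.
  move=> n m nm; apply/subsetPset => x; rewrite /F /= !in_itv/= => /andP[nx xn].
  have nm2 : n.+2%:R <= m.+2%:R :> R by rewrite ler_nat.
  apply/andP; split; last exact: le_trans nm2.
  by apply: le_trans nx; rewrite lef_pV2 ?posrE.
have mF i : measurable (F i) by exact: measurable_itv.
have h : (\int[mu]_(x in F i) (dominating q x)%:E)%E @[i --> \oo] -->
    (\int[mu]_(x in \bigcup_n F n) (dominating q x)%:E)%E.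
  apply: ge0_nondecreasing_set_cvg_integral => //.
    move=> i; apply/measurable_EFinP; apply: measurable_funTS.
    exact: measurable_dominating.
  by move=> i x _; rewrite lee_fin dominating_ge0.
apply: (cvge_to_le h); apply: nearW => n; apply: integral_dominating_itv => //.
have : 1 < n.+2%:R :> R by rewrite ltr1n.
by move=> n1; rewrite (lt_trans _ n1)// invf_lt1// (lt_trans ltr01).
Qed.

Lemma integrable_dominating q : 0 < q -> q < 1 ->
  mu.-integrable setT (EFin \o dominating q).
Proof.
move=> q0 q1; apply/integrableP; split.
  by apply/measurable_EFinP; exact: measurable_dominating.
have -> : (\int[mu]_x `|(EFin \o dominating q) x| =
    \int[mu]_x (dominating q x)%:E)%E.
  by apply: eq_integral => x _; rewrite gee0_abs// lee_fin dominating_ge0.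
have mD D : measurable_fun D (EFin \o dominating q).
  apply/measurable_EFinP; apply: measurable_funTS; exact: measurable_dominating.
have TU : [set: R] = `]-oo, 0]%classic `|` `]0, +oo[%classic.
  apply/seteqP; split => x //= _; rewrite !in_itv/= andbT.
  by case: leP => _; [left|right].
rewrite TU ge0_integral_setU//=; last 3 first.
- exact: mD.
- by move=> x _; rewrite lee_fin dominating_ge0.
- apply/disj_setPS => x [] /=; rewrite !in_itv/= andbT => x0 x1.
  by move: (lt_le_trans x1 x0); rewrite ltxx.
have pos := integral_dominating_pos q0 q1.
apply: lte_add_pinfty.
  apply: (@le_lt_trans _ _ (\int[mu]_(x in `[0%R, +oo[) (dominating q x)%:E)%E).
    rewrite (@ge0_integration_by_substitution0 _ (EFin \o dominating q))//.
    - rewrite le_eqVlt; apply/orP; left; apply/eqP.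
      by apply: eq_integral => x _; rewrite /= /dominating normrN.
    - by move=> x; rewrite lee_fin dominating_ge0.
  exact: le_lt_trans pos (ltry _).
apply: (@le_lt_trans _ _ (\int[mu]_(x in `[0%R, +oo[) (dominating q x)%:E)%E).
  apply: ge0_subset_integral => //.
  - exact: mD.
  - by move=> x _; rewrite lee_fin dominating_ge0.
  - by move=> x /=; rewrite !in_itv/= !andbT => /ltW.
exact: le_lt_trans pos (ltry _).
Qed.

(** Raise the cubic bound to the power p / 3. The weight times the majorant is (1 + |x|)^(2 p - 2),
    at least 1 because p >= 1; the majorant is integrable for 2 p / 3 < 1. *)
Lemma powR_le_dominating p M (d x : R) : 1 <= p -> x != 0 -> 0 <= d ->
  d ^+ 3 * x ^+ 2 * (1 + `|x|) ^+ 4 <= M ->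
  d `^ p <= M `^ (p / 3) * dominating (2 * p / 3) x.
Proof.
move=> p1 x0 d0 hM; set t := `|x|; have t0 : 0 < t by rewrite normr_gt0.
have t1 : 1 <= 1 + t by rewrite lerDl ltW.
have t1' : 0 < 1 + t by exact: lt_le_trans t1.
have p3 : 0 <= p / 3 by rewrite divr_ge0// (le_trans ler01).
pose s := (t ^+ 2 * (1 + t) ^+ 4) `^ (p / 3).
have s1 : 1 <= s * dominating (2 * p / 3) x.
  have -> : s * dominating (2 * p / 3) x = (1 + t) `^ (2 * p - 2).
    rewrite /s /dominating -/t powRM ?exprn_ge0 ?(ltW t0) ?(ltW t1')//.
    rewrite -!powR_mulrn ?(ltW t0) ?(ltW t1')// -!powRrM.
    have -> : 2%:R * (p / 3) = 2 * p / 3 by ring.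
    rewrite mulrACA -[X in X * _ = _]powRD ?(gt_eqF t0) ?implybT// subrr powRr0 mul1r.
    rewrite -powRD ?(gt_eqF t1') ?implybT//; congr (_ `^ _); by field.
  by rewrite -[leLHS](powRr0 (1 + t)) ler_powR// subr_ge0 ler_peMr.
have dp : d `^ p * s <= M `^ (p / 3).
  have -> : d `^ p = (d ^+ 3) `^ (p / 3).
    by rewrite -powR_mulrn// -powRrM; congr (_ `^ _); field.
  have x2 : x ^+ 2 = t ^+ 2 by rewrite real_normK ?num_real.
  rewrite /s -powRM ?exprn_ge0 ?mulr_ge0 ?exprn_ge0 ?(ltW t0) ?(ltW t1')//.
  have h0 : 0 <= d ^+ 3 * (t ^+ 2 * (1 + t) ^+ 4).
    by rewrite !mulr_ge0 ?exprn_ge0 ?(ltW t0) ?(ltW t1').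
  rewrite x2 -mulrA in hM.
  by apply: ge0_ler_powR; rewrite ?nnegrE//; exact: le_trans hM.
apply: (@le_trans _ _ (d `^ p * (s * dominating (2 * p / 3) x))).
  by rewrite ler_peMr// powR_ge0.
by rewrite mulrA ler_wpM2r// dominating_ge0.
Qed.

End DominatingFunction.

(** * Dominated convergence in L^p *)

Section DominatedLp.
Variable R : realType.
Implicit Types (p x e : R).
Notation mu := (@lebesgue_measure R).

Lemma norm_powR_cvg0 (T : Type) (F : set_system T) {FF : Filter F} p (y : T -> R) :
  1 <= p -> y t @[t --> F] --> 0 -> `|y t| `^ p @[t --> F] --> 0.
Proof.
move=> p1 y0; apply/cvgrPdist_le => e e0.
have em0 : 0 < Num.min e 1 by rewrite lt_min e0 ltr01.
move/cvgrPdist_le : y0 => /(_ _ em0); apply: filterS => t.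
rewrite !sub0r !normrN le_min => /andP[ye y1].
rewrite ger0_norm ?powR_ge0//; apply: le_trans ye.
have [->|yt] := eqVneq `|y t| 0; first by rewrite powR0// gt_eqF// (lt_le_trans ltr01).
rewrite -[leRHS]powRr1//; apply: ger_powR => //.
by rewrite y1 andbT lt_neqAle eq_sym yt normr_ge0.
Qed.

(** Dominated convergence concerns sequences, so the limit is tested along sequences decreasing to 0
    in value, shifted by [N] because the bound holds only for k near 0. The point x = 0 is a null
    set. *)
Lemma integral_powR_cvg0 p (f : R -> R -> R) (g : R -> R) : 1 <= p ->
  mu.-integrable setT (EFin \o g) ->
  (\forall k \near 0^'+, measurable_fun setT (f k) /\
     forall x, x != 0 -> `|f k x| `^ p <= g x) ->
  (forall x, x != 0 -> f k x @[k --> 0^'+] --> 0) ->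
  (\int[mu]_x (`|f k x| `^ p)%:E)%E @[k --> 0^'+] --> 0%E.
Proof.
move=> p1 ig fg f0; apply/cvge_at_rightP => s [s0 sc].
have sr : s n @[n --> \oo] --> 0^'+.
  move=> A /= [e /= e0 eA].
  have : \forall n \near \oo, `|0 - s n| < e.
    by move/cvgrPdist_lt : sc => /(_ e e0).
  by apply: filterS => n; exact: (fun h => eA (s n) h (s0 n)).
have [N _ HN] := sr _ fg.
have mf n : measurable_fun setT (fun x => (`|f (s (n + N)%N) x| `^ p)%:E).
  have [mfn _] := HN (n + N)%N (leq_addl _ _).
  apply/measurable_EFinP; apply: (@measurableT_comp _ _ _ _ _ _ (@powR R ^~ p)) => //.
  exact: measurableT_comp.
have ae0 (P : R -> Prop) : (forall x, x != 0 -> P x) -> {ae mu, forall x, P x}.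
  move=> HP; exists [set 0]; split => //; first exact: lebesgue_measure_set1.
  move=> x /= nP; apply: contrapT => /eqP x0; apply: nP; exact: HP.
have m0 : measurable_fun setT (cst 0%E : R -> \bar R) by exact: measurable_cst.
have lim : {ae mu, forall x, setT x ->
    (`|f (s (n + N)%N) x| `^ p)%:E @[n --> \oo] --> cst 0%E x}.
  apply: ae0 => x x0 _; apply: cvg_EFin; first exact: nearW.
  apply: norm_powR_cvg0 => //.
  rewrite (cvg_shiftn N (fun n => f (s n) x)).
  exact: cvg_comp sr (f0 x x0).
have dom : {ae mu, forall x, forall n, setT x ->
    (`|(`|f (s (n + N)%N) x| `^ p)%:E| <= (EFin \o g) x)%E}.
  apply: ae0 => x x0 n _; rewrite abse_EFin ger0_norm ?powR_ge0// lee_fin.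
  by have [_] := HN (n + N)%N (leq_addl _ _); exact.
have [_ _ cv] := @dominated_convergence _ (measurableTypeR R) R mu setT measurableT
  (fun n x => (`|f (s (n + N)%N) x| `^ p)%:E) (cst 0%E) (EFin \o g) mf m0 lim ig dom.
rewrite integral0 in cv.
by rewrite -(cvg_shiftn N).
Qed.

Lemma LnormE p (f : R -> R) :
  ('N[mu]_(p%:E)[EFin \o f] = (\int[mu]_x (`|f x| `^ p)%:E) `^ p^-1)%E.
Proof.
by rewrite unlock; congr (poweR _ _); apply: eq_integral.
Qed.

Lemma Lnorm_cvg0 p (f : R -> R -> R) : 1 <= p ->
  (\int[mu]_x (`|f k x| `^ p)%:E)%E @[k --> 0^'+] --> 0%E ->
  'N[mu]_(p%:E)[EFin \o f k]%E @[k --> 0^'+] --> 0%E.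
Proof.
move=> p1 I0; have p0 : 0 < p by exact: lt_le_trans ltr01 p1.
have J0 k : (0 <= \int[mu]_x (`|f k x| `^ p)%:E)%E.
  by apply: integral_ge0 => x _; rewrite lee_fin powR_ge0.
apply: cvge0_near_le => [k|e e0]; first by rewrite LnormE poweR_ge0.
have : \forall k \near 0^'+, (\int[mu]_x (`|f k x| `^ p)%:E <= (e `^ p)%:E)%E.
  have [fI rI] := (fine_cvgP _ _).1 I0.
  have ep : 0 < e `^ p by rewrite powR_gt0.
  move/cvgrPdist_le : rI => /(_ _ ep); apply: filterS2 fI => k kf /=.
  rewrite sub0r normrN ger0_norm ?fine_ge0// => h.
  by rewrite -(fineK kf) lee_fin.
apply: filterS => k Ik; rewrite LnormE.
have -> : e%:E = ((e `^ p)%:E `^ p^-1)%E.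
  by rewrite poweR_EFin -powRrM divff ?gt_eqF// powRr1// ltW.
apply: gt0_ler_poweR => //; first by rewrite invr_ge0 ltW.
- by rewrite in_itv/= J0 leey.
- by rewrite in_itv/= lee_fin powR_ge0 leey.
Qed.

Lemma Lfun_dominated p (f g : R -> R) : 1 <= p ->
  mu.-integrable setT (EFin \o g) -> (forall x, 0 <= g x) ->
  measurable_fun setT f ->
  (forall x, x != 0 -> `|f x| `^ p <= g x) -> f \in Lfun mu p%:E.
Proof.
move=> p1 ig g0 mf fg; rewrite inE; apply/andP; split; first by rewrite inE/=.
rewrite inE/= /finite_norm LnormE; apply: poweR_lty.
apply: le_lt_trans (integrable_lty measurableT ig).
apply: ae_ge0_le_integral => //.
- apply/measurable_EFinP; apply: (@measurableT_comp _ _ _ _ _ _ (@powR R ^~ p)) => //.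
  exact: measurableT_comp.
- by move=> x _; rewrite lee_fin.
- by have /integrableP[] := ig.
- exists [set 0]; split => //; first exact: lebesgue_measure_set1.
  move=> x /= nP; apply: contrapT => /eqP x0; apply: nP => _.
  by rewrite lee_fin fg.
Qed.

Lemma measurable_fun_derivable_off0 (f : R -> R) :
  (forall x, x != 0 -> derivable f x 1) -> measurable_fun setT f.
Proof.
move=> df; rewrite -(setvU [set 0]); apply/measurable_funU => //.
  exact: measurableC.
split; last exact: measurable_fun_set1.
apply: open_continuous_measurable_fun; first by apply: closed_openC; exact: closed_eq.
move=> x; rewrite inE/= => /eqP x0.
by apply: differentiable_continuous; apply/derivable1_diffP; exact: df.
Qed.

End DominatedLp.

(** * Convergence of the densities *)

Section DensityConvergence.
Variable R : realType.
Implicit Types (k x : R).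
Notation mu := (@lebesgue_measure R).
Variables (c : R -> R) (rho v phi : R -> R -> R).
Hypothesis hc : forall k, 0 <= k -> peaked_speed k (c k).
Hypothesis hw : forall k, 0 <= k ->
  peaked_solitary_wave k (c k) (rho k) (v k) (phi k).
Let ck k : 0 <= k -> Num.sqrt k < c k.
Proof. by move=> k0; apply: peaked_speed_gt => //; exact: hc. Qed.
Let H k (k0 : 0 <= k) := family_half_wave hc hw k0.
Let u k x := c k - v k x.

Lemma density_norm k x : 0 <= k -> x != 0 -> rho k x = rho k (- `|x|).
Proof.
move=> k0 x0; have [xp|xn] := ltP 0 x.
  by rewrite gtr0_norm//; have [->] := psw_even (hw k0) x0.
by rewrite ler0_norm// opprK.
Qed.

Lemma density_bound k tau X B x : 0 <= k -> 1 < tau -> X < 0 ->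
  tau <= u k X ^+ 2 - k -> c k <= B -> x != 0 ->
  0 <= rho k x - 1 /\
  (rho k x - 1) ^+ 3 * x ^+ 2 * (1 + `|x|) ^+ 4 <= density_const tau X B.
Proof.
move=> k0 tau1 X0 uX cB x0.
have y0 : - `|x| < 0 by rewrite oppr_lt0 normr_gt0.
rewrite density_norm// (rhoE (ck k0) (hw k0) y0).
have := hw_density_bound (H k0) tau1 X0 uX cB y0.
by rewrite opprK sqrrN real_normK ?num_real.
Qed.

Lemma measurable_density k : 0 <= k -> measurable_fun setT (fun x => rho k x - 1).
Proof.
move=> k0; apply: measurable_funB; last exact: measurable_cst.
apply: measurable_fun_derivable_off0 => x x0.
by have [] := psw_derivable (hw k0) x0.
Qed.

Variable p : R.
Hypothesis hp : 1 <= p < 3 / 2.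
Let p1 : 1 <= p. Proof. by case/andP: hp. Qed.
Let q0 : 0 < 2 * p / 3. Proof. by rewrite divr_gt0// mulr_gt0// (lt_le_trans ltr01). Qed.
Let q1 : 2 * p / 3 < 1. Proof. by have /andP[_] := hp; lra. Qed.

Let g tau X B x : R := density_const tau X B `^ (p / 3) * dominating (2 * p / 3) x.

Let ig tau X B : mu.-integrable setT (EFin \o g tau X B).
Proof.
rewrite (_ : EFin \o g tau X B = (fun x =>
    (density_const tau X B `^ (p / 3))%:E * (EFin \o dominating (2 * p / 3)) x)%E).
  by apply: integrableZl => //; exact: integrable_dominating.
by apply/funext => x; rewrite /= -EFinM.
Qed.

Let g0 tau X B x : 0 <= g tau X B x.
Proof. by rewrite mulr_ge0 ?powR_ge0 ?dominating_ge0. Qed.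

Lemma density_Lfun k : 0 <= k -> (fun x => rho k x - 1) \in Lfun mu p%:E.
Proof.
move=> k0; have [X [tau [X0 tau1 uX]]] := hw_tail_exists (H k0).
apply: (@Lfun_dominated _ p _ (g tau X (c k)) p1) => //.
  exact: measurable_density.
move=> x x0; have [d0 dM] := density_bound k0 tau1 X0 uX (lexx _) x0.
by rewrite ger0_norm//; exact: powR_le_dominating.
Qed.

Lemma speed_cvg : c k @[k --> 0^'+] --> c 0.
Proof.
apply/cvgrPdist_le => e e0; apply: filterS (near_speed hc hw e0) => k [k0].
by rewrite distrC; have := sqrtr_ge0 k; lra.
Qed.

Lemma u_cvg x : x < 0 -> u k x @[k --> 0^'+] --> u 0 x.
Proof.
move=> x0; apply/cvgrPdist_le => e e0.
by apply: filterS (near_half_wave hc hw e0) => k [_ _ /(_ x x0)]; rewrite distrC.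
Qed.

Lemma density_cvg x : x != 0 -> rho k x @[k --> 0^'+] --> rho 0 x.
Proof.
move=> x0; have y0 : - `|x| < 0 by rewrite oppr_lt0 normr_gt0.
have l : c k / u k (- `|x|) @[k --> 0^'+] --> c 0 / u 0 (- `|x|).
  apply: cvgM; first exact: speed_cvg.
  apply: cvgV; last exact: u_cvg.
  by rewrite gt_eqF// (hw_u_gt0 (H (lexx 0)) y0).
rewrite density_norm// (rhoE (ck (lexx 0)) (hw (lexx 0)) y0).
apply: cvg_trans l; apply: near_eq_cvg; near=> k.
have k0 : 0 <= k by apply/ltW; near: k; exact: nbhs_right_gt.
by rewrite density_norm// (rhoE (ck k0) (hw k0) y0).
Unshelve. all: by end_near. Qed.

Lemma density_cvg_Lp : cvg0_Lp p (fun k x => rho k x - 1).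
Proof.
split; first exact: density_Lfun.
have [X [tau [X0 tau1 uX]]] := hw_tail_exists (H (lexx 0)).
(* Lowering tau to the midpoint of 1 and tau leaves the slack by which the tail condition at the
   same X survives for all small k. *)
pose tau' : R := (1 + tau) / 2.
have tau'1 : 1 < tau' by rewrite /tau'; lra.
have uX0 : tau' <= u 0 X ^+ 2 - 0 by move: uX; rewrite /tau' /u; lra.
pose B : R := c 0 + 1.
have bound0 x : x != 0 -> 0 <= rho 0 x - 1 /\ (rho 0 x - 1) `^ p <= g tau' X B x.
  move=> x0; have c0B : c 0 <= B by rewrite /B; lra.
  have [d0 dM] := density_bound (lexx 0) tau'1 X0 uX0 c0B x0.
  by split => //; exact: powR_le_dominating.
apply: Lnorm_cvg0 => //; apply: (integral_powR_cvg0 p1 (ig tau' X B)).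
  have uXc : u k X * u k X - k @[k --> 0^'+] --> u 0 X * u 0 X - 0.
    apply: cvgB; first by apply: cvgM; exact: u_cvg.
    by apply: cvg_at_right_filter; exact: cvg_id.
  near=> k.
  have k0 : 0 <= k by apply/ltW; near: k; exact: nbhs_right_gt.
  have uXk : tau' <= u k X ^+ 2 - k.
    by near: k; apply: (cvgr_ge _ uXc); move: uX; rewrite /tau' /u; lra.
  have cB : c k <= B.
    by near: k; apply: (cvgr_le _ speed_cvg); rewrite /B; lra.
  split.
    by apply: measurable_funB; exact: measurable_density.
  move=> x x0; have [d0 dg] := bound0 x x0.
  have [e0 eM] := density_bound k0 tau'1 X0 uXk cB x0.
  have eg : (rho k x - 1) `^ p <= g tau' X B x by exact: powR_le_dominating.
  have pw : 0 <= p by exact: le_trans ler01 p1.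
  (* Both densities are at least 1, so their distance is at most the larger of rho k - 1 and rho 0 -
     1, and the same majorant serves without a further constant. *)
  have [le|le] := leP (rho 0 x) (rho k x).
    apply: le_trans eg; apply: ge0_ler_powR; rewrite ?nnegrE//=.
    by rewrite ger0_norm; lra.
  apply: le_trans dg; apply: ge0_ler_powR; rewrite ?nnegrE//=.
  by rewrite ler0_norm; lra.
move=> x x0 /=; rewrite -[X in _ --> X](subrr (rho 0 x - 1)).
apply: cvgB; last exact: cvg_cst.
by apply: cvgB; [exact: density_cvg|exact: cvg_cst].
Unshelve. all: by end_near. Qed.

End DensityConvergence.

Unset Implicit Arguments.

Theorem theorem1p3 (R : realType) (c : R -> R) (rho v phi : R -> R -> R)
  (hc : forall k : R, 0 <= k -> peaked_speed k (c k))
  (hw : forall k : R, 0 <= k ->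
    peaked_solitary_wave k (c k) (rho k) (v k) (phi k))
  (alpha beta p : R)
  (halpha : 0 < alpha < 1 / 3) (hbeta : 0 < beta < 2 / 3)
  (hp : 1 <= p < 3 / 2) :
  [/\ cvg0_holder1 alpha phi,
      cvg0_Lp p (fun (k x : R) => rho k x - 1)
    & cvg0_holder beta v].
Proof.
split.
- exact: (potential_cvg_holder1 hc hw halpha).
- exact: (density_cvg_Lp hc hw hp).
- exact: (velocity_cvg_holder hc hw hbeta).
Qed.
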